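(* Let $r$ be a positive integer with $r\not\equiv 0\pmod 3$. Then there are infinitely many fields $K\in\mathfrak{F}$ (pairwise non-isomorphic) whose ideal class group contains an ideal class of order $r$.
   Context: For an integer $n$ let $f_n(X)=X^3+nX^2+nX-1$. For odd $n\ge5$, $f_n$ is irreducible over $\mathbb{Q}$ with three real roots and Galois group $S_3$; let $K_n=\mathbb{Q}(\rho)$ with $\rho$ a root of $f_n$ (a non-Galois real cubic field). Let $\mathfrak{F}=\{K_n: n \text{ an odd integer}\ge 5\}$. *)

(* Defs.v *)
From HB Require Import structures.
From mathcomp Require Import all_boot all_order all_algebra all_field.
From mathcomp Require Import boolp classical_sets.

Set Implicit Arguments.
Unset Strict Implicit.
Unset Printing Implicit Defensive.

Import GRing.Theory.
Local Open Scope ring_scope.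
Local Open Scope quotient_scope.
Local Open Scope classical_set_scope.

Section FractionalIdeals.
Variable K : fieldExtType rat.
Implicit Types I J H : set K.

Definition ring_of_integers : set K := integralOver (intr : int -> K).
Local Notation OK := ring_of_integers.

Definition O_submodule I :=
  [/\ I 0, forall x y, I x -> I y -> I (x + y)
    & forall a x, OK a -> I x -> I (a * x)].

Definition fractional_ideal I :=
  O_submodule I /\
  exists d, [/\ d != 0, OK d & forall x, I x -> OK (d * x)].

Definition ideal_mul I J : set K :=
  [set x | exists2 s : seq (K * K),
      (forall p, p \in s -> I p.1 /\ J p.2) & x = \sum_(p <- s) p.1 * p.2].

Definition principal_ideal (a : K) : set K := [set a * x | x in OK].

(* OK being a Dedekind domain, these are exactly its nonzero fractional
   ideals; asking for an inverse makes the group laws below elementary. *)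
Definition invertible_ideal I :=
  fractional_ideal I /\ exists2 J, fractional_ideal J & ideal_mul I J = OK.

Lemma integers0 : OK 0. Proof. exact: (integral0 intr). Qed.
Lemma integers1 : OK 1. Proof. exact: (integral1 intr). Qed.
Lemma integersD x y : OK x -> OK y -> OK (x + y).
Proof. exact: (@integral_add _ _ (intr : {rmorphism int -> K})). Qed.
Lemma integersM x y : OK x -> OK y -> OK (x * y).
Proof. exact: (@integral_mul _ _ (intr : {rmorphism int -> K})). Qed.

Lemma ideal_mul_in I J x y : I x -> J y -> ideal_mul I J (x * y).
Proof.
move=> Ix Jy; exists [:: (x, y)]; last by rewrite big_seq1.
by move=> p; rewrite inE => /eqP->.
Qed.

Lemma ideal_mul0 I J : ideal_mul I J 0.
Proof. by exists [::]; rewrite ?big_nil. Qed.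

Lemma ideal_mulD I J x y :
  ideal_mul I J x -> ideal_mul I J y -> ideal_mul I J (x + y).
Proof.
case=> s sP -> [t tP ->]; exists (s ++ t); last by rewrite big_cat.
by move=> p; rewrite mem_cat => /orP[/sP|/tP].
Qed.

Lemma ideal_mul_min I J H :
    H 0 -> (forall x y, H x -> H y -> H (x + y)) ->
    (forall x y, I x -> J y -> H (x * y)) ->
  forall z, ideal_mul I J z -> H z.
Proof.
move=> H0 HD HM z [s sP ->]; rewrite big_seq.
by elim/big_ind: _ => // p /sP[]; apply: HM.
Qed.

Lemma ideal_mulC I J : ideal_mul I J = ideal_mul J I.
Proof.
apply/seteqP; split; apply: ideal_mul_min;
  by [exact: ideal_mul0 | exact: ideal_mulD
     | move=> x y Ix Jy; rewrite mulrC; apply: ideal_mul_in].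
Qed.

Lemma ideal_mulA_sub I J H z :
  ideal_mul I (ideal_mul J H) z -> ideal_mul (ideal_mul I J) H z.
Proof.
apply: ideal_mul_min; [exact: ideal_mul0 | exact: ideal_mulD | move=> x y Ix].
apply: (@ideal_mul_min _ _
  [set y | ideal_mul (ideal_mul I J) H (x * y)]) => /=.
- by rewrite mulr0; apply: ideal_mul0.
- by move=> u v; rewrite mulrDr; apply: ideal_mulD.
- by move=> u v Ju Hv; rewrite mulrA; do 2?apply: ideal_mul_in.
Qed.

Lemma ideal_mulA I J H :
  ideal_mul I (ideal_mul J H) = ideal_mul (ideal_mul I J) H.
Proof.
apply/seteqP; split=> z; first exact: ideal_mulA_sub.
rewrite ideal_mulC (ideal_mulC I) => /ideal_mulA_sub.
by rewrite ideal_mulC (ideal_mulC H).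
Qed.

Lemma ideal_mul1 I : O_submodule I -> ideal_mul OK I = I.
Proof.
case=> I0 ID IM; apply/seteqP; split; first exact: ideal_mul_min.
by move=> x Ix /=; rewrite -[x]mul1r; apply: ideal_mul_in => //; apply: integers1.
Qed.

Lemma fractional_mul I J :
  fractional_ideal I -> fractional_ideal J -> fractional_ideal (ideal_mul I J).
Proof.
move=> [[I0 ID IM] [d [d0 Od dI]]] [_ [e [e0 Oe eJ]]]; split.
  split; [exact: ideal_mul0 | exact: ideal_mulD | move=> a x Oa].
  move: x; apply: (@ideal_mul_min _ _ [set x | ideal_mul I J (a * x)]) => /=.
  - by rewrite mulr0; apply: ideal_mul0.
  - by move=> u v; rewrite mulrDr; apply: ideal_mulD.
  - by move=> u v Iu Jv; rewrite mulrA; apply: ideal_mul_in => //; apply: IM.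
exists (d * e); split; [by rewrite mulf_neq0 | exact: integersM | ].
apply: (@ideal_mul_min _ _ [set x | OK (d * e * x)]) => /=.
- by rewrite mulr0; apply: integers0.
- by move=> u v; rewrite mulrDr; apply: integersD.
- by move=> u v /dI Iu /eJ Jv; rewrite mulrACA; apply: integersM.
Qed.

Lemma fractional_integers : fractional_ideal OK.
Proof.
split; first by split; [exact: integers0 | exact: integersD | exact: integersM].
exists 1; split; [exact: oner_neq0 | exact: integers1 | ].
by move=> x; rewrite mul1r.
Qed.

Lemma invertible_integers : invertible_ideal OK.
Proof.
split; first exact: fractional_integers.
exists OK; first exact: fractional_integers.
by rewrite ideal_mul1 //; case: fractional_integers.
Qed.

Lemma invertible_mul I J :
  invertible_ideal I -> invertible_ideal J -> invertible_ideal (ideal_mul I J).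
Proof.
move=> [fI [I' fI' II']] [fJ [J' fJ' JJ']]; split; first exact: fractional_mul.
exists (ideal_mul J' I'); first exact: fractional_mul.
by rewrite -ideal_mulA (ideal_mulA J) JJ' ideal_mul1 //; case: fI'.
Qed.

Lemma principal_ideal1 : principal_ideal 1 = OK.
Proof.
apply/seteqP; split=> [_ [x Ox <-]|x Ox]; first by rewrite mul1r.
by exists x; rewrite ?mul1r.
Qed.

Lemma principal_idealM a b :
  ideal_mul (principal_ideal a) (principal_ideal b) = principal_ideal (a * b).
Proof.
apply/seteqP; split; last first.
  move=> _ [x Ox <-]; rewrite -mulrA; apply: ideal_mul_in; last by exists x.
  by exists 1; [exact: integers1 | rewrite mulr1].
apply: ideal_mul_min.
- by exists 0; [exact: integers0 | rewrite mulr0].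
- move=> _ _ [x Ox <-] [y Oy <-]; exists (x + y); last by rewrite mulrDr.
  exact: integersD.
- move=> _ _ [x Ox <-] [y Oy <-]; exists (x * y); last by rewrite mulrACA.
  exact: integersM.
Qed.

Record inv_ideal := InvIdeal {
  ideal_set :> set K;
  inv_idealP : `[< invertible_ideal ideal_set >] }.

HB.instance Definition _ := [isSub for ideal_set].
HB.instance Definition _ := [Choice of inv_ideal by <:].

Lemma inv_ideal_invertible (I : inv_ideal) : invertible_ideal I.
Proof. exact/asboolP/inv_idealP. Qed.

Definition one_inv_ideal := InvIdeal (introT (asboolP _) invertible_integers).

Definition mul_inv_ideal (I J : inv_ideal) :=
  InvIdeal (introT (asboolP _)
    (invertible_mul (inv_ideal_invertible I) (inv_ideal_invertible J))).

Lemma inv_ideal_exV (I : inv_ideal) :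
  exists J : inv_ideal, mul_inv_ideal J I == one_inv_ideal.
Proof.
have [fI [J fJ IJ]] := inv_ideal_invertible I.
have iJ : invertible_ideal J by split=> //; exists I => //; rewrite ideal_mulC.
exists (InvIdeal (introT (asboolP _) iJ)); apply/eqP/val_inj => /=.
by rewrite ideal_mulC.
Qed.

Definition inv_inv_ideal (I : inv_ideal) : inv_ideal := xchoose (inv_ideal_exV I).

Lemma mul_inv_idealA : associative mul_inv_ideal.
Proof. by move=> I J H; apply: val_inj; apply: ideal_mulA. Qed.

Lemma mul_inv_idealC : commutative mul_inv_ideal.
Proof. by move=> I J; apply: val_inj; apply: ideal_mulC. Qed.

Lemma mul1_inv_ideal : left_id one_inv_ideal mul_inv_ideal.
Proof.
move=> I; apply: val_inj; apply: ideal_mul1.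
by case: (inv_ideal_invertible I) => -[].
Qed.

Lemma mulV_inv_ideal : left_inverse one_inv_ideal inv_inv_ideal mul_inv_ideal.
Proof. by move=> I; apply/eqP/(xchooseP (inv_ideal_exV I)). Qed.

Lemma mul_inv_ideal1 : right_id one_inv_ideal mul_inv_ideal.
Proof. by move=> I; rewrite mul_inv_idealC mul1_inv_ideal. Qed.

Lemma mul_inv_idealV : right_inverse one_inv_ideal inv_inv_ideal mul_inv_ideal.
Proof. by move=> I; rewrite mul_inv_idealC mulV_inv_ideal. Qed.

HB.instance Definition _ := isGroup.Build inv_ideal mul_inv_idealA
  mul1_inv_ideal mul_inv_ideal1 mulV_inv_ideal mul_inv_idealV.

Definition is_principal (I : inv_ideal) :=
  exists2 a : K, a != 0 & ideal_set I = principal_ideal a.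

Lemma is_principal1 : is_principal 1%g.
Proof. by exists 1; rewrite ?oner_neq0 // principal_ideal1. Qed.

Lemma is_principalM (I J : inv_ideal) :
  is_principal I -> is_principal J -> is_principal (I * J)%g.
Proof.
move=> [a a0 Ia] [b b0 Jb]; exists (a * b); first by rewrite mulf_neq0.
by rewrite -principal_idealM -Ia -Jb.
Qed.

Lemma is_principalV (I : inv_ideal) : is_principal I -> is_principal (I^-1)%g.
Proof.
move=> [a a0 Ia]; exists a^-1; first by rewrite invr_eq0.
have IV : ideal_mul I (I^-1)%g = OK.
  by have /(congr1 ideal_set) := mulgV I.
have : ideal_mul (principal_ideal a^-1) (ideal_mul I (I^-1)%g)
       = principal_ideal a^-1.
  by rewrite IV -principal_ideal1 principal_idealM mulr1.
rewrite ideal_mulA Ia principal_idealM mulVf // principal_ideal1 ideal_mul1 //.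
by case: (inv_ideal_invertible (I^-1)%g) => -[].
Qed.

Definition same_class (I J : inv_ideal) := `[< is_principal (I / J)%g >].

Lemma same_class_refl : reflexive same_class.
Proof. by move=> I; apply/asboolP; rewrite mulgV; apply: is_principal1. Qed.

Lemma same_class_sym : symmetric same_class.
Proof.
by move=> I J; apply/asboolP/asboolP => /is_principalV; rewrite invgF.
Qed.

Lemma same_class_trans : transitive same_class.
Proof.
move=> J I H /asboolP IJ /asboolP JH; apply/asboolP.
by have := is_principalM IJ JH; rewrite mulgA mulgVK.
Qed.

Canonical same_class_equiv :=
  EquivRel same_class same_class_refl same_class_sym same_class_trans.

Definition class_group := {eq_quot same_class}.
HB.instance Definition _ := Choice.on class_group.
HB.instance Definition _ := Quotient.on class_group.

Definition ideal_class (I : inv_ideal) : class_group := \pi_class_group I.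

Lemma ideal_class_ind (P : class_group -> Prop) :
  (forall I : inv_ideal, P (ideal_class I)) -> forall c, P c.
Proof. by move=> PI c; rewrite -[c]reprK; apply: PI. Qed.

Lemma ideal_classP (I J : inv_ideal) :
  ideal_class I = ideal_class J <-> is_principal (I / J)%g.
Proof.
by split=> [/eqmodP/asboolP|IJ] //; apply/eqmodP/asboolP.
Qed.

Lemma mulgC_inv_ideal (I J : inv_ideal) : (I * J = J * I)%g.
Proof. exact: mul_inv_idealC. Qed.

Definition class_mul (c d : class_group) : class_group :=
  ideal_class (repr c * repr d)%g.
Definition class_inv (c : class_group) : class_group := ideal_class (repr c)^-1%g.

Lemma ideal_classM (I J : inv_ideal) :
  ideal_class (I * J)%g = class_mul (ideal_class I) (ideal_class J).
Proof.
have PI (H : inv_ideal) : is_principal (H / repr (ideal_class H))%g.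
  by apply/ideal_classP; rewrite /ideal_class reprK.
apply/ideal_classP; have := is_principalM (PI I) (PI J).
set I' := repr _; set J' := repr _.
rewrite (_ : I * J / (I' * J') = I / I' * (J / J'))%g // invgM -!mulgA.
congr (_ * _)%g.
by rewrite [RHS]mulgC_inv_ideal -mulgA.
Qed.

Lemma ideal_classV (I : inv_ideal) :
  ideal_class (I^-1)%g = class_inv (ideal_class I).
Proof.
apply/ideal_classP; rewrite invgK mulgC_inv_ideal.
by apply/ideal_classP; rewrite /ideal_class reprK.
Qed.

Lemma class_mulA : associative class_mul.
Proof.
elim/ideal_class_ind=> I; elim/ideal_class_ind=> J.
by elim/ideal_class_ind=> H; rewrite -!ideal_classM mulgA.
Qed.

Lemma class_mul1 : left_id (ideal_class 1%g) class_mul.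
Proof. by elim/ideal_class_ind=> I; rewrite -ideal_classM mul1g. Qed.

Lemma class_1mul : right_id (ideal_class 1%g) class_mul.
Proof. by elim/ideal_class_ind=> I; rewrite -ideal_classM mulg1. Qed.

Lemma class_mulV : left_inverse (ideal_class 1%g) class_inv class_mul.
Proof. by elim/ideal_class_ind=> I; rewrite -ideal_classV -ideal_classM mulVg. Qed.

Lemma class_Vmul : right_inverse (ideal_class 1%g) class_inv class_mul.
Proof. by elim/ideal_class_ind=> I; rewrite -ideal_classV -ideal_classM mulgV. Qed.

HB.instance Definition _ := isGroup.Build class_group class_mulA
  class_mul1 class_1mul class_mulV class_Vmul.

End FractionalIdeals.

(* The library's #[x] is only defined for finite groups. *)
Definition has_order (G : groupType) (x : G) (r : nat) :=
  [/\ (0 < r)%N, (x ^+ r = 1)%g & forall k, (0 < k < r)%N -> (x ^+ k)%g <> 1%g].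

Definition f_poly (n : int) : {poly int} := 'X^3 + n *: 'X^2 + n *: 'X - 1.

(* Fields are abstract extensions of rat: this determines K_n up to
   isomorphism whenever f_poly n is irreducible over rat. *)
Definition is_K (n : int) (K : fieldExtType rat) :=
  exists2 rho : K, root (map_poly intr (f_poly n)) rho & <<1; rho>>%VS = fullv.

Definition family_F (K : fieldExtType rat) :=
  exists n : int, [/\ 5 <= n, ~~ (2 %| n)%Z & is_K n K].

Definition field_iso (K L : fieldExtType rat) :=
  exists phi : {rmorphism K -> L}, bijective phi.

(* Main.v *)
Require Import Defs.
From HB Require Import structures.
From mathcomp Require Import all_boot all_order all_algebra all_field.
From mathcomp Require Import boolp classical_sets.
From mathcomp Require Import realalg zify ring lra.

(* For y = 1 mod 444 put n = (y^r - 7) / 6, so that f_n(2) = y^r.  The number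
   gamma = rho - 2 has norm -y^r and is coprime to its cofactor y^r / gamma, hence
   (gamma) is the r-th power of the ideal (y, gamma).  The class of this ideal has
   order exactly r unless gamma = u a^p with p | r prime and u a unit.  By
   Dirichlet's pigeonhole argument the units rho, eps = (rho + 1)^3 / 2 and u are
   multiplicatively dependent, and one gets rho^i eps^j gamma^k = +- b^p with b
   in K and i, j, k bounded and not all divisible by p.

   At two real places b is O(1/y), while at the third one it is P(y) + O(1/y),
   where P is a real polynomial depending only on (p, i, j, k) whose leading
   coefficient c satisfies c^p 2^j 6^(i + 3 j + k) = 1.  As the trace of b is an
   integer, P(y) is within O(1/y) of an integer, where c is irrational up to an
   exceptional case in which gamma / rho = +- b^p; then the norm of b - 1 is too
   small.  Similarly K_n and K_m can only be isomorphic if disc(f_m) disc(f_n) is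
   a square, which for fixed m makes sqrt(disc f_m) ((y^r - 7)^2 / 36 - 9) close to
   an integer.

   Finally, finitely many real polynomials with irrational leading coefficients
   cannot cover all large y in this way: by pigeonhole one of them would be close
   to integers on a whole Hilbert cube with bounded sides, and then a suitable
   iterated finite difference would make a bounded nonzero multiple of its
   leading coefficient arbitrarily close to an integer. *)

Set Implicit Arguments.
Unset Strict Implicit.
Unset Printing Implicit Defensive.

Import Order.TTheory GRing.Theory Num.Theory.
Local Open Scope ring_scope.

(** * Polynomials far from integers *)

(** Hilbert cube with base point [y] and sides [hs]. Peeling off one side leaves a cube and its
    translate by [h], which is how a forward difference with step [h] combines values. *)
Fixpoint cube (B : nat -> Prop) (hs : seq nat) (y : nat) : Prop :=
  if hs is h :: hs' then cube B hs' y /\ cube B hs' (y + h)%N else B y.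

Lemma cube_take B hs k y : cube B hs y -> cube B (take k hs) y.
Proof.
elim: hs k y => [|h hs IH] [|k] y //=; last by case=> /IH ? /IH.
by case=> /(IH 0%N); rewrite take0.
Qed.

Lemma sub_cube (B B' : nat -> Prop) hs y :
  (forall z, (y <= z)%N -> B z -> B' z) -> cube B hs y -> cube B' hs y.
Proof.
elim: hs y => [|h hs IH] y sBB' /=; first exact: sBB'.
case=> c1 c2; split; apply: IH => // z yz; apply: sBB'.
exact: leq_trans (leq_addr _ _) yz.
Qed.

(** Induction on the dimension: after [x], take more disjoint blocks of length [W.+1] than there are
    pairs of a colour and a list of sides. Two blocks then contain translates of one cube in one
    colour, and the distance between their base points is the new side. It matters that the bound on
    the sides does not depend on [x]. *)
Lemma hilbert_cube (I : finType) (B : I -> nat -> Prop) (x0 : nat) :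
  (forall y, (x0 <= y)%N -> exists i, B i y) ->
  forall D, exists W, forall x, (x0 <= x)%N -> exists i hs y,
    [/\ size hs = D, {in hs, forall h, 0 < h <= W}%N, (x <= y <= x + W)%N
      & cube (B i) hs y].
Proof.
move=> colB; elim=> [|D [W IH]].
  exists 0%N => x /colB[i Bi]; exists i, [::], x; split=> //.
  by rewrite addn0 leqnn.
pose T : finType := (I * D.-tuple 'I_W.+1)%type.
exists (W.+1 * #|T|.+2)%N => x x0x.
have col (l : 'I_#|T|.+1) : exists t : T * nat,
  [/\ {in map val t.1.2, forall h, 0 < h}%N,
      (x + W.+1 * l <= t.2 <= x + W.+1 * l + W)%N
    & cube (B t.1.1) (map val t.1.2) t.2].
  have [|i [hs [y [shs hsW yW cB]]]] := IH (x + W.+1 * l)%N.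
    exact: leq_trans x0x (leq_addr _ _).
  have hsE : map val (map (@inord W) hs) = hs.
    rewrite -map_comp -[RHS]map_id; apply/eq_in_map => h /hsW /andP[_ hW] /=.
    by rewrite inordK.
  have s' : size (map (@inord W) hs) == D by rewrite size_map shs.
  exists ((i, Tuple s'), y) => /=.
  by rewrite hsE; split=> // h /hsW/andP[].
have [f fP] := choice col.
have /injectivePn[l1 [l2 l12 fl12]] : ~~ injectiveb (fst \o f).
  apply/injectiveP => /(leq_card (fst \o f)); rewrite card_ord ltnn //.
wlog lt12 : l1 l2 l12 fl12 / (l1 < l2)%N.
  move=> wl; have [lt|lt|/val_inj/eqP] := ltngtP l1 l2; first exact: wl lt.
    by apply: wl lt; rewrite // eq_sym.
  by rewrite (negPf l12).
have [pos1 y1 c1] := fP l1; have [_ y2] := fP l2.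
have e12 : (f l1).1 = (f l2).1 by exact: fl12.
rewrite -e12 => c2; set hs := map _ _ in pos1 c1 c2.
have W12 : (W.+1 * l1 + W.+1 <= W.+1 * l2)%N by rewrite addnC -mulnS leq_mul2l lt12 orbT.
have l2T : (W.+1 * l2 <= W.+1 * #|T|)%N by rewrite leq_mul2l -ltnS ltn_ord orbT.
have mE : (W.+1 * #|T|.+2 = W.+1 * #|T| + W.+1 + W.+1)%N.
  by rewrite -addn2 mulnDr muln2 -addnn addnA.
rewrite mE; exists (f l1).1.1, (((f l2).2 - (f l1).2)%N :: hs), (f l1).2.
move: (W.+1 * l1)%N (W.+1 * l2)%N (W.+1 * #|T|)%N W12 l2T y1 y2 => k1 k2 k3 W12 l2T y1 y2.
have [xy1 lt_y y12W] : [/\ (x <= (f l1).2 <= x + (k3 + W.+1 + W.+1))%N,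
    ((f l1).2 < (f l2).2)%N & ((f l2).2 <= (f l1).2 + (k3 + W.+1 + W.+1))%N].
  by split; lia.
split=> /=.
- by rewrite size_map size_tuple.
- move=> h; rewrite inE => /orP[/eqP->|hhs]; first by rewrite subn_gt0 lt_y leq_subLR.
  rewrite pos1 //=; case/mapP: hhs => j _ ->.
  apply: leq_trans (ltnW (ltn_ord j)) _.
  exact: leq_addl.
- exact: xy1.
- by split=> //; rewrite subnKC // ltnW.
Qed.

(** * Forward differences of polynomials *)

Section Difference.
Variable R : comNzRingType.
Implicit Types (P : {poly R}) (h : nat).

Definition fwd_diff h P := P \Po ('X + h%:R%:P) - P.

Lemma horner_fwd_diff h P x : (fwd_diff h P).[x] = P.[x + h%:R] - P.[x].
Proof. by rewrite !hornerE horner_comp !hornerE. Qed.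

Lemma size_diff_Xn h i : (size (('X + h%:R%:P) ^+ i - 'X^i : {poly R})%R <= i)%N.
Proof.
elim: i => [|i IH]; first by rewrite !expr0 subrr size_poly0.
have -> : ('X + h%:R%:P) ^+ i.+1 - 'X^(i.+1) =
  ('X + h%:R%:P) * (('X + h%:R%:P) ^+ i - 'X^i) + h%:R%:P * 'X^i :> {poly R}.
  by rewrite !exprS; ring.
apply: leq_trans (size_polyD _ _) _; rewrite geq_max; apply/andP; split.
  by apply: leq_trans (size_polyMleq _ _) _; rewrite size_XaddC.
by rewrite mul_polyC; apply: leq_trans (size_scale_leq _ _) _; rewrite size_polyXn.
Qed.

Lemma coef_diff_Xn h i :
  (('X + h%:R%:P) ^+ i.+1 - 'X^(i.+1) : {poly R})`_i = (i.+1 * h)%:R.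
Proof.
elim: i => [|i IH].
  by rewrite !expr1 addrAC subrr add0r coefC mul1n.
have -> : ('X + h%:R%:P) ^+ i.+2 - 'X^(i.+2) =
  (('X + h%:R%:P) ^+ i.+1 - 'X^(i.+1)) * 'X
  + h%:R%:P * (('X + h%:R%:P) ^+ i.+1 - 'X^(i.+1)) + h%:R%:P * 'X^(i.+1) :> {poly R}.
  by rewrite (exprS _ i.+1) (exprS 'X i.+1); ring.
rewrite !coefD coefMX /= IH !coefCM coefXn eqxx mulr1.
rewrite [X in _ * X]nth_default ?mulr0 ?addr0; last exact: size_diff_Xn.
by rewrite -natrD; congr (_%:R); lia.
Qed.

Lemma fwd_diffE h P d : (size P <= d)%N ->
  fwd_diff h P = \sum_(i < d) P`_i *: (('X + h%:R%:P) ^+ i - 'X^i).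
Proof.
move=> sP; rewrite /fwd_diff comp_polyE.
have -> : \sum_(i < size P) P`_i *: ('X + h%:R%:P) ^+ i
   = \sum_(i < d) P`_i *: ('X + h%:R%:P) ^+ i.
  rewrite (big_ord_widen_cond d xpredT (fun i => P`_i *: ('X + h%:R%:P) ^+ i)) //.
  rewrite big_mkcond; apply: eq_bigr => i _ /=; case: ifPn => //.
  by rewrite -leqNgt => si; rewrite nth_default // scale0r.
have {2}-> : P = \sum_(i < d) P`_i *: 'X^i.
  rewrite -poly_def; apply/polyP => i; rewrite coef_poly.
  by case: ltnP => // di; rewrite nth_default // (leq_trans sP).
by rewrite -sumrB; apply: eq_bigr => i _; rewrite scalerBr.
Qed.

Lemma size_fwd_diff h P d : (size P <= d.+1)%N -> (size (fwd_diff h P) <= d)%N.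
Proof.
move=> sP; rewrite (fwd_diffE h sP).
apply: leq_trans (size_sum _ _ _) _; apply/bigmax_leqP => i _.
apply: leq_trans (size_scale_leq _ _) (leq_trans (size_diff_Xn _ _) _).
by rewrite -ltnS.
Qed.

Lemma coef_fwd_diff h P d : (size P <= d.+2)%N ->
  (fwd_diff h P)`_d = (d.+1 * h)%:R * P`_d.+1.
Proof.
move=> sP; rewrite (fwd_diffE h sP) coef_sum big_ord_recr /= coefZ coef_diff_Xn.
rewrite big1 ?add0r 1?mulrC // => i _; rewrite coefZ [X in _ * X]nth_default ?mulr0 //.
by apply: leq_trans (size_diff_Xn _ _) _; rewrite -ltnS.
Qed.

(** A difference with step [h] multiplies the top coefficient by its degree times [h]. The
    accumulated factor [q] is positive and bounded independently of the actual steps. *)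
Lemma iter_fwd_diff (W d : nat) P hs : (size P <= d.+1)%N ->
    (size hs <= d)%N -> {in hs, forall h, 0 < h <= W}%N ->
  (size (foldr fwd_diff P hs) <= (d - size hs).+1)%N /\
  exists2 q : nat, (0 < q <= d ^ size hs * W ^ size hs)%N
    & (foldr fwd_diff P hs)`_(d - size hs) = q%:R * P`_d.
Proof.
move=> sP; elim: hs => [|h hs IH] /=.
  by rewrite subn0 => *; split=> //; exists 1%N; rewrite ?mul1r.
move=> lt_hs hsW; case: IH => [|g ghs|sQ [q /andP[q0 qW] Qd]].
- exact: ltnW.
- by apply: hsW; rewrite inE ghs orbT.
have /andP[h0 hW] : (0 < h <= W)%N by apply: hsW; rewrite mem_head.
have dE : (d - size hs = (d - (size hs).+1).+1)%N by rewrite subnSK.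
rewrite dE in sQ Qd; split; first exact: size_fwd_diff.
exists ((d - (size hs).+1).+1 * h * q)%N.
  rewrite !muln_gt0 h0 q0 /= !expnS mulnACA; apply: leq_mul qW.
  by apply: leq_mul hW; rewrite -dE leq_subr.
by rewrite coef_fwd_diff // Qd mulrA -natrM.
Qed.

End Difference.

Section FarFromIntegers.
Variable R : archiRcfType.
Implicit Types (P : {poly R}) (a e : R).

Definition irrational a :=
  forall (q : nat) (z : int), (0 < q)%N -> z%:~R != q%:R * a.

Definition near_int e (a : R) := exists z : int, `|a - z%:~R| <= e.

(** Each difference subtracts two values close to integers, so the error at most doubles with every
    side. *)
Lemma cube_near_int e P hs y :
    cube (fun y => near_int e P.[y%:R]) hs y ->
  near_int (e *+ 2 ^ size hs) (foldr (@fwd_diff R) P hs).[y%:R].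
Proof.
elim: hs y => [|h hs IH] y /=; first by rewrite expn0 mulr1n.
case=> /IH[z1 z1P] /IH[z2 z2P]; exists (z2 - z1).
rewrite horner_fwd_diff -natrD rmorphB /= expnS mul2n -addnn [e *+ _]mulrnDr.
rewrite opprB [z1%:~R - _]addrC addrACA; apply: le_trans (ler_normD _ _) _.
by apply: lerD z2P _; rewrite addrC distrC.
Qed.

(** Finitely many multiples of [a] are involved, none of them an integer; the nearest integer to
    each is its floor or the successor of its floor. *)
Lemma irrational_gap a (Q : nat) : irrational a ->
  exists2 d : R, 0 < d & forall (q : nat) (z : int), (0 < q <= Q)%N ->
    d <= `|q%:R * a - z%:~R|.
Proof.
move=> irr; elim: Q => [|Q [d d0 dP]].
  by exists 1; rewrite ?ltr01 // => q z; case: q.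
pose b : R := Q.+1%:R * a; pose f := Num.floor b.
have fb : f%:~R <= b < f%:~R + 1.
  by have := floor_itv b; rewrite -/f rmorphD /=.
have fNb : f%:~R != b by apply: irr.
have d'0 : 0 < Num.min (b - f%:~R) (f%:~R + 1 - b).
  case/andP: fb => fb1 fb2; rewrite lt_min !subr_gt0 fb2 andbT.
  by rewrite lt_def eq_sym fNb.
exists (Num.min d (Num.min (b - f%:~R) (f%:~R + 1 - b))); first by rewrite lt_min d0.
move=> q z /andP[q0]; rewrite leq_eqVlt => /orP[/eqP->|qQ]; last first.
  by apply: le_trans (dP q z _); rewrite ?ge_min ?lexx // q0.
rewrite ge_min; apply/orP; right; rewrite -/b.
have [zf|fz] := lerP z f.
  rewrite ge_min; apply/orP; left; apply: le_trans (ler_norm _).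
  by rewrite lerD2l lerN2 ler_int.
rewrite ge_min; apply/orP; right; rewrite distrC; apply: le_trans (ler_norm _).
by rewrite lerD2r -[1]/(1%:~R) -rmorphD ler_int lezD1.
Qed.

(** Otherwise the index [i] colours all [y] from [Y0] on. On a monochromatic cube the iterated
    difference of [P i] is the constant [q * lead_coef (P i)] with [q] bounded, while its distance
    to an integer tends to 0 as [x] grows, against [irrational_gap]. *)
Lemma exists_far (I : finType) (P : I -> {poly R}) (C : R) (Y0 : nat) :
    (forall i, 1 < size (P i))%N -> (forall i, irrational (lead_coef (P i))) ->
  exists2 y : nat, (Y0 <= y)%N & forall i, ~ near_int (C / y%:R) (P i).[y%:R].
Proof.
move=> sP irrP; apply: contrapT => nex.
pose B i y := near_int (C / y%:R) (P i).[y%:R].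
have colB y : (Y0 <= y)%N -> exists i, B i y.
  move=> Yy; apply: contrapT => nB; apply: nex; exists y => // i Bi.
  by apply: nB; exists i.
(* One dimension for all colours; the cube is later cut down to the degree of the polynomial
   found. *)
pose D := \max_i (size (P i)).-1.
have [W cubeW] := hilbert_cube colB D.
have gap i : exists d : R, 0 < d /\ forall (q : nat) (z : int),
    (0 < q <= (size (P i)).-1 ^ (size (P i)).-1 * W ^ (size (P i)).-1)%N ->
    d <= `|q%:R * lead_coef (P i) - z%:~R|.
  by have [d d0 dP] := irrational_gap ((size (P i)).-1 ^ (size (P i)).-1 * W ^ (size (P i)).-1)
    (irrP i); exists d.
have [d dP] := choice gap.
(* Beyond [N i] the accumulated error [|C| * 2 ^ D / x] is below the gap [d i]. *)
pose N i := Num.bound (`|C| *+ 2 ^ D / d i).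
pose x := (maxn Y0 (\max_i N i)).+1.
have [|i [hs [y [shs hsW /andP[xy _] cB]]]] := cubeW x.
  by rewrite leqW // leq_maxl.
have sPi : (size (P i)).-1.+1 = size (P i) by rewrite prednK // (ltn_trans _ (sP i)).
set k := (size (P i)).-1 in sPi.
have kD : (k <= D)%N by rewrite /D /k (leq_bigmax_cond (F := fun i => (size (P i)).-1)).
have x0 : 0 < x%:R :> R by rewrite ltr0n.
have {}cB : cube (fun y => near_int (`|C| / x%:R) (P i).[y%:R]) (take k hs) y.
  apply: cube_take; apply: sub_cube cB => z yz [m mP]; exists m.
  apply: le_trans mP _; have z0 : 0 < z%:R :> R.
    by rewrite ltr0n (leq_trans _ yz) // (leq_trans _ xy).
  apply: le_trans (ler_wpM2r _ (ler_norm C)) _; first by rewrite invr_ge0 ltW.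
  by rewrite ler_wpM2l // lef_pV2 // ?posrE // ler_nat (leq_trans xy).
have sk : size (take k hs) = k by rewrite size_takel // shs.
have /cube_near_int[z] := cB; rewrite sk.
have [|||sQ [q qP Qk]] := @iter_fwd_diff R W k (P i) (take k hs).
- by rewrite sPi.
- by rewrite sk.
- by move=> h /mem_take; apply: hsW.
rewrite sk subnn in sQ Qk qP.
rewrite (size1_polyC sQ) hornerC Qk -/(lead_coef _) => le1.
have [d0 dmin] := dP i; have le2 := dmin q z qP.
have := le_trans le2 le1; apply/negP; rewrite -ltNge.
have : `|C| *+ 2 ^ D / d i < x%:R.
  apply: lt_trans (archi_boundP _) _.
    by rewrite divr_ge0 ?mulrn_wge0 ?(ltW d0).
  by rewrite ltr_nat ltnS leq_max (leq_bigmax (F := N)) orbT.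
rewrite ltr_pdivrMr // mulrC -ltr_pdivrMr // => lt1; apply: le_lt_trans lt1.
rewrite mulrnAl ler_wpMn2l //; last by rewrite leq_exp2l.
by rewrite divr_ge0 // ltW.
Qed.

End FarFromIntegers.

(** * The asymptotic expansion at the third real place *)

Section Expansion.
Variable R : archiRcfType.
Implicit Types (P S V g h : {poly R}) (x y u v w : R).

Lemma exists_root (p : nat) (a : R) : (0 < p)%N -> 0 < a ->
  exists2 c, 0 < c & c ^+ p = a.
Proof.
move=> p0 a0; have a1 : 1 <= 1 + a by rewrite lerDl ltW.
have le_a : a <= (1 + a) ^+ p.
  apply: le_trans (_ : 1 + a <= _); first by rewrite lerDr.
  by rewrite -{1}[1 + a]expr1 ler_weXn2l.
have [||c /andP[c0 _]] := @poly_ivt R ('X^p - a%:P) 0 (1 + a).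
- by apply: le_trans a1.
- by rewrite !hornerE expr0n (gtn_eqF p0) sub0r oppr_le0 ltW //= subr_ge0.
rewrite /root !hornerE subr_eq0 => /eqP cp; exists c => //.
by rewrite lt_def c0 andbT; apply: contra_eqN cp => /eqP->; rewrite expr0n (gtn_eqF p0) lt_eqF.
Qed.

(** [b ^+ p.-1] is one of the nonnegative terms of the cofactor of [a - b] in [a ^+ p - b ^+ p].
    This carries estimates from [p]-th powers over to [p]-th roots. *)
Lemma subX_geMl (p : nat) (a b : R) : (0 < p)%N -> 0 <= a -> 0 <= b ->
  `|a - b| * b ^+ p.-1 <= `|a ^+ p - b ^+ p|.
Proof.
case: p => // p _ a0 b0; rewrite subrXX normrM ler_wpM2l //.
have sum_ge0 n (f : 'I_n -> nat) : 0 <= \sum_(i < n) a ^+ f i * b ^+ i.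
  by apply: sumr_ge0 => i _; apply: mulr_ge0; apply: exprn_ge0.
rewrite ger0_norm // big_ord_recr /= subnn expr0 mul1r lerDr.
by apply: sumr_ge0 => i _; apply: mulr_ge0; apply: exprn_ge0.
Qed.

Lemma poly_bounded P : exists2 C, 0 <= C & forall x, `|x| <= 1 -> `|P.[x]| <= C.
Proof.
exists (\sum_(i < size P) `|P`_i|); first exact: sumr_ge0.
move=> x x1; rewrite horner_coef; apply: le_trans (ler_norm_sum _ _ _) _.
apply: ler_sum => i _; rewrite normrM normrX.
by rewrite -[leRHS]mulr1 ler_wpM2l // exprn_ile1.
Qed.

(** [S] is the power series of the [p]-th root of [g / h], truncated at order [K] and found
    coefficient by coefficient: adding [a *: 'X^K] to [S] changes the coefficient of degree [K] in
    [S ^+ p * h] by [p * a]. *)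
Lemma root_series (p K : nat) g h : (0 < p)%N -> g.[0] = 1 -> h.[0] = 1 ->
  exists S, S.[0] = 1 /\ exists Q, S ^+ p * h - g = 'X^K * Q.
Proof.
move=> p0 g0 h0; elim: K => [|K [S [S0 [Q QE]]]].
  by exists 1; rewrite hornerC; split=> //; eexists; rewrite expr0 mul1r.
pose a := - Q.[0] / p%:R; pose T := S + a *: 'X^K.
have T0 : T.[0] = 1.
  rewrite /T hornerD S0 hornerZ hornerXn expr0n; case: K QE {T} => [|K] QE /=.
    (* For [K = 0] the constant term of [S] must stay 1; indeed [Q.[0] = 0] there, so that
       [a = 0]. *)
    rewrite /a -[Q]mul1r -[1 * Q]/('X^0 * Q) -QE.
    by rewrite !hornerE S0 expr1n h0 g0 mul1r subrr oppr0 !mul0r addr0.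
  by rewrite mulr0 addr0.
pose W := \sum_(i < p) T ^+ (p.-1 - i) * S ^+ i.
have TS : T ^+ p - S ^+ p = (a *: 'X^K) * W.
  by rewrite subrXX; congr (_ * _); rewrite /T addrC addKr.
have : ((Q + a *: (W * h)).[0] == 0).
  rewrite hornerD hornerZ hornerM h0 mulr1 /W horner_sum.
  under eq_bigr do rewrite hornerM !horner_exp T0 S0 !expr1n mulr1.
  rewrite sumr_const card_ord /a divfK ?subrr //.
  by rewrite pnatr_eq0 -lt0n.
move/factor_theorem => [Q' Q'E]; exists T; split=> //; exists Q'.
rewrite exprSr -mulrA [_ * Q']mulrC -[X in _ * (_ * X)]subr0 -polyC0 -Q'E.
rewrite mulrDr -QE -[T ^+ p](subrK (S ^+ p)) TS -!mul_polyC; ring.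
Qed.

(** Lipschitz in [v], uniformly in [x]. The bound on the values is included in order that products
    keep the property. *)
Definition lipschitz (f : R -> R -> R) := exists2 C, 0 <= C &
  forall x v w, 0 <= x <= 1 -> 0 <= v <= 2 -> 0 <= w <= 2 ->
    `|f x v| <= C /\ `|f x v - f x w| <= C * `|v - w|.

Lemma lipschitzM f f' : lipschitz f -> lipschitz f' ->
  lipschitz (fun x v => f x v * f' x v).
Proof.
move=> [C C0 fC] [C' C'0 f'C]; exists (C * C' *+ 2); first by rewrite mulrn_wge0 ?mulr_ge0.
move=> x v w x01 v02 w02.
have [f1 f2] := fC x v w x01 v02 w02; have [f1' f2'] := f'C x v w x01 v02 w02.
have [g1 _] := f'C x w v x01 w02 v02.
split.
  rewrite normrM; apply: le_trans (ler_pM _ _ f1 f1') _; rewrite ?normr_ge0 //.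
  by rewrite mulr2n lerDl mulr_ge0.
have -> : f x v * f' x v - f x w * f' x w
   = f x v * (f' x v - f' x w) + (f x v - f x w) * f' x w by ring.
apply: le_trans (ler_normD _ _) _; rewrite mulr2n [leRHS]mulrDl !normrM.
apply: lerD; first by rewrite -mulrA ler_pM.
by rewrite mulrAC ler_pM.
Qed.

Lemma lipschitzX f n : lipschitz f -> lipschitz (fun x v => f x v ^+ n).
Proof.
move=> lf; elim: n => [|n IH]; last first.
  have [C C0 CP] := lipschitzM lf IH; exists C => // x v w x01 v02 w02.
  by rewrite !exprS; apply: CP.
exists 1 => // x v w _ _ _; rewrite !expr0 subrr normr0 normr1 lexx.
by rewrite mul1r normr_ge0.
Qed.

Lemma lipschitz_affine (a b c : R) : lipschitz (fun x v => a + b * v + c * (x * v)).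
Proof.
exists (`|a| + `|b| * 2 + `|c| * 2).
  by rewrite !addr_ge0 ?mulr_ge0.
move=> x v w /andP[x0 x1] /andP[v0 v2] /andP[w0 w2]; split.
  apply: le_trans (ler_normD _ _) (lerD (le_trans (ler_normD _ _) (lerD _ _)) _) => //.
    by rewrite normrM ler_wpM2l // ger0_norm.
  rewrite normrM ler_wpM2l // ger0_norm ?mulr_ge0 //.
  by apply: le_trans (ler_wpM2r v0 x1) _; rewrite mul1r.
have -> : a + b * v + c * (x * v) - (a + b * w + c * (x * w)) = (b + c * x) * (v - w) by ring.
rewrite normrM ler_wpM2r //.
apply: le_trans (ler_normD _ _) _; rewrite normrM (ger0_norm x0).
have := ler_wpM2l (normr_ge0 c) x1; have := normr_ge0 a; have := normr_ge0 b.
have := normr_ge0 c; lra.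
Qed.

(* Successive approximations, as polynomials in x, of the fixed point v(x) = 1 + O(x)
   of the equation in [newton_approx]. With x = 1 / (6 n + 7), the root of f_n near
   -n is -1 / (6 x v(x)). *)
Fixpoint newton (k : nat) : {poly R} := if k is k'.+1 then
  let V := newton k' in
  1 + 'X * (7%:R *: V + 6%:R *: V ^+ 2) - 42%:R *: ('X ^+ 2 * V ^+ 2)
    + 216%:R *: ('X ^+ 3 * V ^+ 3)
  else 1.

Lemma newton0 k : (newton k).[0] = 1.
Proof.
case: k => [|k]; first by rewrite hornerC.
by rewrite /= !hornerE ?(expr0n, mul0r, mulr0, subr0, addr0) /=
    ?(expr0n, mul0r, mulr0, subr0, addr0).
Qed.

(** For [x <= 1 / 100] the right-hand side maps the interval from 0 to 2 into itself and contracts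
    it by the factor [60 * x]. *)
Lemma newton_approx k x v : 0 <= x <= 1 / 100%:R -> 0 <= v <= 2 ->
    v = 1 + x * (7 * v + 6 * v ^+ 2) - 42 * (x ^+ 2 * v ^+ 2) + 216 * (x ^+ 3 * v ^+ 3) ->
  0 <= (newton k).[x] <= 2 /\ `|v - (newton k).[x]| <= (60 * x) ^+ k.
Proof.
move=> /andP[x0 x1] /andP[v0 v2] vE; elim: k => [|k [/andP[V0 V2] IH]].
  rewrite /= hornerC expr0; split; first by rewrite ler01 ler1n.
  by rewrite ler_norml; lra.
have x3_le : x ^+ 3 <= x / 100.
  rewrite exprS ler_wpM2l // expr2 -[leRHS]mulr1.
  by apply: ler_pM => //; lra.
have x2_le : x ^+ 2 <= x / 100 by rewrite expr2 ler_wpM2l //; lra.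
have x2_ge : 0 <= x ^+ 2 by exact: exprn_ge0.
have x3_ge : 0 <= x ^+ 3 by exact: exprn_ge0.
have bnd (c M t : R) : 0 <= c -> 0 <= t <= M -> 0 <= c * t <= c * M.
  by move=> c0 /andP[t0 tM]; rewrite mulr_ge0 //= ler_wpM2l.
set V := (newton k).[x] in V0 V2 IH *.
have -> : (newton k.+1).[x] =
    1 + x * (7 * V + 6 * V ^+ 2) - 42 * (x ^+ 2 * V ^+ 2) + 216 * (x ^+ 3 * V ^+ 3).
  by rewrite /= !hornerE -/V; ring.
have V2_bnd : 0 <= V ^+ 2 <= 4 by rewrite exprn_ge0 //=; nra.
have V3_bnd : 0 <= V ^+ 3 <= 8.
  rewrite exprn_ge0 //= exprS (_ : 8 = 2 * 4); last by ring.
  by case/andP: V2_bnd => ? ?; apply: ler_pM.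
have sq_bnd : 0 <= 7 * V + 6 * V ^+ 2 <= 38 by case/andP: V2_bnd => ? ?; lra.
split.
  have /andP[? ?] := bnd _ _ _ x0 sq_bnd.
  have /andP[? ?] := bnd _ _ _ x2_ge V2_bnd.
  have /andP[? ?] := bnd _ _ _ x3_ge V3_bnd.
  by apply/andP; split; lra.
(* The cofactors of [v - V] in the differences of squares and of cubes. The resulting contraction
   factor is at most 7 + 24 + 26 times [x]. *)
pose s := v + V; pose t := v ^+ 2 + v * V + V ^+ 2.
have s_bnd : 0 <= s <= 4 by rewrite /s; lra.
have t_bnd : 0 <= t <= 12.
  have vV : 0 <= v * V <= 2 * 2 by rewrite mulr_ge0 //= ler_pM.
  have vv : 0 <= v ^+ 2 <= 2 * 2 by rewrite exprn_ge0 //= expr2 ler_pM.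
  by rewrite /t; lra.
rewrite {1}vE (_ : _ - _ = (7 * x + 6 * (x * s) - 42 * (x ^+ 2 * s)
   + 216 * (x ^+ 3 * t)) * (v - V)); last by rewrite /s /t; ring.
rewrite normrM [leRHS]exprS; apply: ler_pM => //.
have /andP[? ?] := bnd _ _ _ x0 s_bnd.
have /andP[? ?] := bnd _ _ _ x2_ge s_bnd.
have /andP[? ?] := bnd _ _ _ x3_ge t_bnd.
by rewrite ler_norml; apply/andP; split; lra.
Qed.

(* Applied with B the absolute value of the p-th root b at the third place: the
   two last hypotheses are proved in [place3_equations]. *)
Lemma near_expansion (p s b c M : nat) : (0 < p)%N -> (0 < s)%N -> (0 < M)%N ->
  exists P (C : R), [/\ (1 < size P)%N,
      0 < lead_coef P /\ lead_coef P ^+ p * (2 ^ b * 6 ^ M)%:R = 1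
    & forall (y : nat) v B, C <= y%:R ->
      let x := (y%:R ^+ (p * s))^-1 in
      1 / 2 <= v <= 2 -> 0 <= B ->
      v = 1 + x * (7 * v + 6 * v ^+ 2) - 42 * (x ^+ 2 * v ^+ 2) + 216 * (x ^+ 3 * v ^+ 3) ->
      B ^+ p * v ^+ M * x ^+ M * (2 ^ b * 6 ^ M)%:R
        = (1 - 6 * (x * v)) ^+ (3 * b) * (1 + 12 * (x * v)) ^+ c ->
      `|B - P.[y%:R]| <= C / y%:R].
Proof.
move=> p0 s0 M0.
(* Order [M + 1] suffices: an error of size [x ^+ K] is later multiplied by [Y ^+ M], where [x] is
   the inverse of [Y ^+ p], and is then at most [1 / y]. *)
pose K := M.+1.
have [V [V0 VP]] : exists V, V.[0] = 1 /\ forall x v,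
    0 <= x <= 1 / 100%:R -> 0 <= v <= 2 ->
    v = 1 + x * (7 * v + 6 * v ^+ 2) - 42 * (x ^+ 2 * v ^+ 2) + 216 * (x ^+ 3 * v ^+ 3) ->
    0 <= V.[x] <= 2 /\ `|v - V.[x]| <= (60 * x) ^+ K.
  by exists (newton K); split; [exact: newton0|exact: newton_approx].
pose G := (1 - 6%:R *: ('X * V)) ^+ (3 * b) * (1 + 12%:R *: ('X * V)) ^+ c.
have G0 : G.[0] = 1.
  by rewrite /G !(hornerM, horner_exp, hornerD, hornerN, hornerZ, hornerX, hornerC)
    !(mul0r, mulr0, oppr0, addr0, expr1n, mulr1).
have H0 : (V ^+ M).[0] = 1 by rewrite horner_exp V0 expr1n.
have [S [S0 [Q SQ]]] := root_series K p0 G0 H0.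
have [c0 c0_gt0 c0E] : exists2 c, 0 < c & c ^+ p = ((2 ^ b * 6 ^ M)%:R)^-1 :> R.
  by apply: exists_root; rewrite // invr_gt0 ltr0n muln_gt0 !expn_gt0.
pose gv x v := (1 + 0 * v + (- 6) * (x * v)) ^+ (3 * b) * (1 + 0 * v + 12 * (x * v)) ^+ c : R.
have [Lg Lg0 gvP] : lipschitz gv.
  by apply: lipschitzM; apply: lipschitzX; apply: lipschitz_affine.
have [Lm Lm0 vMP] : lipschitz (fun x v => (0 + 1 * v + 0 * (x * v)) ^+ M).
  by apply: lipschitzX; apply: lipschitz_affine.
have GE x : G.[x] = gv x V.[x].
  rewrite /G /gv !(hornerM, horner_exp, hornerD, hornerN, hornerZ, hornerX, hornerC).
  by congr (_ ^+ _ * _ ^+ _); ring.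
have [CQ CQ0 QP] := poly_bounded Q.
have [CS CS0 SP] := poly_bounded S.
have [S' S'E] : exists S', S - 1 = S' * 'X.
  have /factor_theorem[S'] : root (S - 1) 0 by rewrite /root !hornerE S0 subrr.
  by rewrite subr0 => ->; exists S'.
have [CS' CS'0 S'P] := poly_bounded S'.
pose C1 := Lg * 60 ^+ K + CQ + CS ^+ p * (Lm * 60 ^+ K).
pose C2 := 2 ^+ p.-1 * (2 ^+ M * C1).
pose C3 := \sum_(l < size S) `|S`_l|.
have C1_ge0 : 0 <= C1 by rewrite !addr_ge0 ?mulr_ge0 ?exprn_ge0.
have C2_ge0 : 0 <= C2 by rewrite !mulr_ge0 ?exprn_ge0.
have C3_ge0 : 0 <= C3 by exact: sumr_ge0.
(* As [x] is the inverse of [Y ^+ p] with [Y = y ^ s], the product [Y ^+ M * S.[x]] is a Laurent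
   polynomial in [Y]. [P0] keeps its terms of nonnegative degree; the others are [O(1 / y)]. *)
pose tm (l : nat) : {poly R} := if (p * l <= M)%N then S`_l *: 'X^(s * (M - p * l)) else 0.
pose P0 := \sum_(l < size S) tm l.
have [sP0 lP0] : (1 < size P0)%N /\ lead_coef P0 = 1.
  have S0' : S`_0 = 1 by rewrite -horner_coef0.
  have [m mE] : exists m, size S = m.+1.
    case: (size S) (size_poly_eq0 S) => [|m] => [/esym/eqP E|_]; last by exists m.
    by move: S0'; rewrite E coef0 => /eqP; rewrite eq_sym oner_eq0.
  have -> : P0 = 'X^(s * M) + \sum_(l < m) tm l.+1.
    by rewrite /P0 mE big_ord_recl /tm muln0 /= subn0 S0' scale1r.
  have sT : (size (\sum_(l < m) tm l.+1)%R < size ('X^(s * M) : {poly R})%R)%N.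
    rewrite size_polyXn ltnS; apply: leq_trans (size_sum _ _ _) _.
    apply/bigmax_leqP => l _; rewrite /tm; case: ifP => [plM|_]; last by rewrite size_poly0.
    apply: leq_trans (size_scale_leq _ _) _; rewrite size_polyXn ltn_mul2l s0 /=.
    by rewrite -subn_gt0 subKn // muln_gt0 p0.
  by rewrite size_polyDl // lead_coefDl // lead_coefXn size_polyXn ltnS muln_gt0 s0.
have [hd hdE] : exists hd : R, hd = 100 by exists 100.
have hd0 : 0 <= hd by rewrite hdE.
exists (c0 *: P0), (hd + CS' * 2 + (c0 * C2 + c0 * C3)); split.
- by rewrite size_scale ?gt_eqF.
- rewrite lead_coefZ lP0 mulr1; split=> //; rewrite c0E mulVf //.
  by rewrite pnatr_eq0 -lt0n muln_gt0 !expn_gt0.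
move=> y v B Cy x /andP[v1 v2] B0 vE BE.
have cC0 : 0 <= c0 * C2 + c0 * C3 by apply: addr_ge0; apply: mulr_ge0 => //; exact: ltW.
have CS'_le : hd + CS' * 2 <= y%:R by apply: le_trans Cy; rewrite lerDl.
have y_ge : 100 <= y%:R :> R.
  by rewrite -hdE; apply: le_trans CS'_le; rewrite lerDl mulr_ge0.
have y_gt0 : 0 < y%:R :> R by apply: lt_le_trans y_ge.
have y1 : 1 <= y%:R :> R by apply: le_trans y_ge; rewrite ler1n.
pose Y : R := y%:R ^+ s.
have yY : y%:R <= Y by rewrite -[leLHS]expr1 ler_weXn2l.
have Y0 : 0 < Y by rewrite exprn_gt0.
have Y1 : 1 <= Y by apply: le_trans yY.
have YxE : Y ^+ p * x = 1 by rewrite /x mulnC exprM divff // gt_eqF ?exprn_gt0.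
have x0 : 0 < x by rewrite invr_gt0 exprn_gt0.
have xy : x <= y%:R^-1.
  rewrite lef_pV2 ?posrE ?exprn_gt0 // mulnC exprM; apply: le_trans yY _.
  by rewrite -[leLHS]expr1 ler_weXn2l.
have x_le : x <= 1 / 100.
  by apply: le_trans xy _; rewrite div1r lef_pV2 ?posrE.
have x01 : 0 <= x <= 1 by rewrite ltW //=; clear -x_le; lra.
have nx1 : `|x| <= 1 by rewrite gtr0_norm //; clear -x_le; lra.
have v02 : 0 <= v <= 2 by clear -v1 v2; lra.
(* Keeps the factor [S.[x] ^+ p.-1] of [subX_geMl] away from 0. *)
have Sx : 1 / 2 <= S.[x].
  have -> : S.[x] = 1 + S'.[x] * x.
    by have := congr1 (horner^~ x) S'E; rewrite !hornerE /= => <-; ring.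
  have : `|S'.[x] * x| <= 1 / 2.
    rewrite normrM (gtr0_norm x0); apply: le_trans (ler_pM _ _ (S'P _ nx1) xy) _ => //.
      exact: ltW.
    by rewrite ler_pdivrMr //; clear -CS'_le hd0; lra.
  by clear; rewrite ler_norml; lra.
have x_dom : 0 <= x <= 1 / 100 by rewrite ltW.
have [Vx02 vVx] := VP _ _ x_dom v02 vE; set e := x ^+ K.
have e0 : 0 <= e by rewrite exprn_ge0 // ltW.
have {}vVx : `|v - V.[x]| <= 60 ^+ K * e by rewrite /e -exprMn.
(* [B] divided by its leading term, to be compared with [S.[x]]: their [p]-th powers satisfy the
   same equation up to [O(x ^+ K)]. *)
pose B' := B / (c0 * Y ^+ M).
have YM0 : 0 < c0 * Y ^+ M by rewrite mulr_gt0 ?exprn_gt0.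
have B'0 : 0 <= B' by rewrite divr_ge0 // ltW.
have B'E : B' ^+ p * v ^+ M = gv x v.
  have -> : gv x v = (1 - 6 * (x * v)) ^+ (3 * b) * (1 + 12 * (x * v)) ^+ c.
    by rewrite /gv; congr (_ ^+ _ * _ ^+ _); ring.
  have e1 : (c0 * Y ^+ M) ^+ p = (2 ^ b * 6 ^ M)%:R^-1 * (Y ^+ p) ^+ M.
    by rewrite exprMn c0E -!exprM [(M * p)%N]mulnC.
  have e2 : (Y ^+ p) ^+ M * x ^+ M = 1 by rewrite -exprMn YxE expr1n.
  rewrite -BE /B' expr_div_n e1; move: e2; set X := _ ^+ M; set Z := x ^+ M => e2.
  have -> : Z = X^-1.
    have X0 : X != 0 by rewrite expf_neq0 // gt_eqF ?exprn_gt0.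
    by apply: (mulfI X0); rewrite e2 divff.
  by rewrite invfM invrK; ring.
have SE : S.[x] ^+ p * V.[x] ^+ M = gv x V.[x] + e * Q.[x].
  by rewrite -GE; have := congr1 (horner^~ x) SQ; rewrite !hornerE /= => <-; ring.
have dist1 : `|(B' ^+ p - S.[x] ^+ p) * v ^+ M| <= C1 * e.
  have -> : (B' ^+ p - S.[x] ^+ p) * v ^+ M = (gv x v - gv x V.[x]) - e * Q.[x]
      - S.[x] ^+ p * (v ^+ M - V.[x] ^+ M).
    by rewrite mulrBl B'E mulrBr SE; ring.
  have [_ d1] := gvP x v V.[x] x01 v02 Vx02.
  have [_] := vMP x v V.[x] x01 v02 Vx02; rewrite !add0r !mul1r !mul0r !addr0 => d2.
  have d3 : `|S.[x] ^+ p| <= CS ^+ p by rewrite normrX lerXn2r ?nnegrE ?SP.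
  have d4 := QP _ nx1.
  apply: le_trans (ler_normB _ _) _; rewrite /C1 mulrDl.
  apply: lerD; [apply: le_trans (ler_normB _ _) _; rewrite mulrDl; apply: lerD|].
  - by apply: le_trans d1 _; rewrite -mulrA ler_wpM2l.
  - by rewrite normrM (ger0_norm e0) mulrC ler_wpM2r.
  rewrite normrM -mulrA; apply: ler_pM => //; apply: le_trans d2 _.
  by rewrite -mulrA ler_wpM2l.
have dist2 : `|B' ^+ p - S.[x] ^+ p| <= 2 ^+ M * C1 * e.
  have vM : (1 / 2) ^+ M <= v ^+ M by clear -v1; rewrite lerXn2r ?nnegrE; lra.
  have v0 : 0 < v ^+ M by clear -v1; rewrite exprn_gt0; lra.
  rewrite -mulrA -ler_pdivrMl ?exprn_gt0 // -exprVn mulrC -div1r.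
  apply: le_trans dist1; rewrite normrM (gtr0_norm v0).
  by rewrite ler_wpM2l.
have dist3 : `|B' - S.[x]| <= C2 * e.
  have S_ge0 : 0 <= S.[x] by clear -Sx; lra.
  have le_e := le_trans (subX_geMl p0 B'0 S_ge0) dist2.
  rewrite /C2 -[leRHS]mulrA -ler_pdivrMl ?exprn_gt0 // -exprVn -div1r.
  apply: le_trans le_e; rewrite mulrC ler_wpM2l //.
  by clear -Sx; rewrite lerXn2r ?nnegrE //; lra.
(* Used for the truncation error and for the discarded Laurent terms alike. *)
have yYx (k l : nat) : (k.+1 <= p * l)%N -> Y ^+ k * x ^+ l <= y%:R^-1.
  move=> kl; have xl : x ^+ l = (Y ^+ (p * l))^-1.
    rewrite exprM -exprVn; congr (_ ^+ _).
    by apply: (mulfI (lt0r_neq0 (exprn_gt0 p Y0))); rewrite YxE divff // gt_eqF ?exprn_gt0.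
  rewrite xl ler_pdivrMr ?exprn_gt0 // -ler_pdivrMl ?invr_gt0 // invrK mulrC.
  apply: le_trans (_ : Y ^+ k.+1 <= _); last by rewrite ler_weXn2l.
  by rewrite exprSr ler_wpM2l // exprn_ge0 // ltW.
have dist4 : `|B - c0 * Y ^+ M * S.[x]| <= c0 * C2 / y%:R.
  have -> : B - c0 * Y ^+ M * S.[x] = c0 * Y ^+ M * (B' - S.[x]).
    by rewrite mulrBr /B' mulrCA divff ?mulr1 ?gt_eqF.
  rewrite normrM (gtr0_norm YM0) -[c0 * C2 / _]mulrA -[leLHS]mulrA ler_wpM2l ?(ltW c0_gt0) //.
  apply: le_trans (ler_wpM2l _ dist3) _; first by rewrite exprn_ge0 // ltW.
  rewrite mulrCA ler_wpM2l // yYx // /K mulnS.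
  by rewrite -[M.+1]addn1 addnC leq_add // leq_pmull.
have dist5 : `|c0 * Y ^+ M * S.[x] - (c0 *: P0).[y%:R]| <= c0 * C3 / y%:R.
  rewrite hornerZ -[c0 * Y ^+ M * _]mulrA -mulrBr normrM (gtr0_norm c0_gt0).
  rewrite -[c0 * C3 / _]mulrA ler_wpM2l ?(ltW c0_gt0) //.
  rewrite horner_coef mulr_sumr horner_sum -sumrB mulr_suml.
  apply: le_trans (ler_norm_sum _ _ _) _; apply: ler_sum => l _.
  rewrite /tm; case: leqP => plM.
    have -> : Y ^+ M * (S`_l * x ^+ l) = S`_l * Y ^+ (M - p * l).
      rewrite -{1}(subnK plM) exprD exprM.
      have -> : Y ^+ (M - p * l) * (Y ^+ p) ^+ l * (S`_l * x ^+ l) =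
         S`_l * Y ^+ (M - p * l) * (Y ^+ p * x) ^+ l by rewrite exprMn; ring.
      by rewrite YxE expr1n mulr1.
    rewrite hornerZ hornerXn exprM subrr normr0 mulr_ge0 // invr_ge0 ltW //.
  rewrite horner0 subr0 mulrCA normrM ler_wpM2l //.
  rewrite ger0_norm; last by rewrite mulr_ge0 ?exprn_ge0 // ltW.
  by apply: yYx.
have := ler_normD (B - c0 * Y ^+ M * S.[x]) (c0 * Y ^+ M * S.[x] - (c0 *: P0).[y%:R]).
rewrite addrA subrK => /le_trans; apply; apply: le_trans (lerD dist4 dist5) _.
rewrite -mulrDl ler_wpM2r ?invr_ge0 ?(ltW y_gt0) //.
by rewrite lerDr; apply: addr_ge0 => //; apply: mulr_ge0.
Qed.

End Expansion.

(** If [a = k / q], then [k ^ p * 2 ^ b * 6 ^ M = q ^ p]. The exponent of 3 forces [p %| M], and the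
    exponent of 2 then forces [p %| b]. *)
Lemma irrational_root (R : archiRcfType) (a : R) (p b M : nat) :
    (0 < p)%N -> 0 < a -> a ^+ p * (2 ^ b * 6 ^ M)%:R = 1 ->
  ~~ ((p %| b) && (p %| M))%N -> irrational a.
Proof.
move=> p0 a0 aE ndvd q z q0; apply/eqP => zE.
have z0 : 0 < z by rewrite -(ltr0z R) zE mulr_gt0 ?ltr0n.
case: z z0 zE => // k k0 kE.
have : (k ^ p * (2 ^ b * 6 ^ M) = q ^ p)%N.
  apply/eqP; rewrite -(eqr_nat R) natrM !natrX -[k%:R]/(k%:~R) kE exprMn.
  by rewrite -mulrA aE mulr1.
have {}k0 : (0 < k)%N by [].
move=> E; case/negP: ndvd.
have lE (l : nat) : (p * logn l k + (b * logn l 2 + M * logn l 6) = p * logn l q)%N.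
  by rewrite -!lognX -!lognM ?muln_gt0 ?expn_gt0 ?k0 // E.
have E2 : (p * logn 2 k + (b + M) = p * logn 2 q)%N by rewrite -lE !muln1.
have E3 : (p * logn 3 k + M = p * logn 3 q)%N by rewrite -lE muln0 muln1.
have pM : (p %| M)%N by rewrite -(dvdn_addr M (dvdn_mulr (logn 3 k) (dvdnn p))) E3 dvdn_mulr.
rewrite pM andbT -(dvdn_addl b pM).
by rewrite -(dvdn_addr _ (dvdn_mulr (logn 2 k) (dvdnn p))) E2 dvdn_mulr.
Qed.

(** * The cubic fields *)

Section IntegralElements.
Variable K : fieldExtType rat.
Implicit Types x y : K.

Lemma integers_int (z : int) : ring_of_integers (z%:~R : K).
Proof. exact: (integral_id (intr : {rmorphism int -> K})). Qed.

Lemma integersN x : ring_of_integers x -> ring_of_integers (- x).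
Proof. exact: (@integral_opp _ _ (intr : {rmorphism int -> K})). Qed.

Lemma integersB x y : ring_of_integers x -> ring_of_integers y -> ring_of_integers (x - y).
Proof. exact: (@integral_sub _ _ (intr : {rmorphism int -> K})). Qed.

Lemma integersX x k : ring_of_integers x -> ring_of_integers (x ^+ k).
Proof.
move=> Ox; elim: k => [|k IH]; first exact: integers1.
by rewrite exprS; apply: integersM.
Qed.

Lemma integers_root_exp x k : (0 < k)%N -> ring_of_integers (x ^+ k) -> ring_of_integers x.
Proof.
move=> k0 [p mon_p px0]; exists (p \Po 'X^k).
  rewrite monicE lead_coef_comp ?size_polyXn // lead_coefXn expr1n mulr1.
  by rewrite -monicE.
by rewrite poly.map_comp_poly map_polyXn /root horner_comp hornerXn.
Qed.

End IntegralElements.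

Lemma integral_rat_int (x : rat) : integralOver (intr : int -> rat) x ->
  exists z : int, x = z%:~R.
Proof.
case=> p mon_p px0.
have xA : ratr x \in Aint.
  apply: (root_monic_Aint (p := map_poly intr p)).
  - move: px0; rewrite -(fmorph_root (ratr : {rmorphism rat -> algC})) -map_poly_comp.
    by congr (root _ _); apply: eq_map_poly => z /=; rewrite rmorph_int.
  - by rewrite monic_map.
  - by apply/polyOverP => i; rewrite coef_map /= intr_int.
have /intrP[z zE] : (ratr x : algC) \is a Num.int by rewrite Cint_rat_Aint ?Crat_rat.
by exists z; apply: (fmorph_inj (ratr : {rmorphism rat -> algC})); rewrite /= zE rmorph_int.
Qed.

(** * The polynomial f_n and its root field *)

Notation f_rat n := (map_poly (intr : int -> rat) (f_poly n)).

Lemma horner_f (A : comNzRingType) (n : int) (x : A) :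
  (map_poly intr (f_poly n)).[x] = x ^+ 3 + n%:~R * x ^+ 2 + n%:~R * x - 1.
Proof.
rewrite /f_poly !rmorphB !rmorphD /= !map_polyZ /= !map_polyXn map_polyX rmorph1.
by rewrite !(hornerD, hornerN, hornerZ, hornerXn, hornerX, hornerC).
Qed.

Lemma f_monic n : f_poly n \is monic.
Proof.
rewrite monicE /f_poly -!addrA lead_coefDl ?lead_coefXn // size_polyXn ltnS.
apply: leq_trans (size_polyD _ _) _; rewrite geq_max; apply/andP; split.
  by apply: leq_trans (size_scale_leq _ _) _; rewrite size_polyXn.
apply: leq_trans (size_polyD _ _) _; rewrite geq_max; apply/andP; split.
  by apply: leq_trans (size_scale_leq _ _) _; rewrite size_polyX.
by rewrite size_polyN size_poly1.
Qed.

Lemma size_f n : size (f_poly n) = 4.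
Proof.
rewrite /f_poly -!addrA size_polyDl size_polyXn // ltnS.
apply: leq_trans (size_polyD _ _) _; rewrite geq_max; apply/andP; split.
  by apply: leq_trans (size_scale_leq _ _) _; rewrite size_polyXn.
apply: leq_trans (size_polyD _ _) _; rewrite geq_max; apply/andP; split.
  by apply: leq_trans (size_scale_leq _ _) _; rewrite size_polyX.
by rewrite size_polyN size_poly1.
Qed.

Lemma size_f_rat n : size (f_rat n) = 4.
Proof. by rewrite size_map_inj_poly ?size_f //; apply: intr_inj. Qed.

(** A rational root would be an integer dividing 1, but f_n(1) = 2n and f_n(-1) = -2. *)
Lemma f_irreducible n : n != 0 -> irreducible_poly (f_rat n).
Proof.
move=> n0; apply: cubic_irreducible; first by rewrite size_f_rat.
move=> x; apply/negP => fx0; have [z xz] : exists z : int, x = z%:~R.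
  apply: integral_rat_int; exists (f_poly n) => //; exact: f_monic.
move: fx0; rewrite /root horner_f xz.
rewrite -!rmorphXn /= -!rmorphM /= -!rmorphD /= -[1]/(1%:~R) -rmorphB /= intr_eq0 => /eqP zE.
have zU : z * (z ^+ 2 + n * z + n) = 1.
  by apply/eqP; rewrite -subr_eq0 -[X in _ == X]zE; apply/eqP; ring.
have : z \is a GRing.unit by apply/unitrPr; exists (z ^+ 2 + n * z + n).
by rewrite qualifE /= => /orP[] /eqP z1; move: zE; rewrite z1 => zE; lia.
Qed.

Lemma exists_K n : n != 0 -> exists K : fieldExtType rat, is_K n K.
Proof.
move=> n0; have irr := f_irreducible n0.
have [z z0] : exists z : algC, root (map_poly ratr (f_rat n)) z.
  by apply: closed_rootP; rewrite size_map_poly size_f_rat.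
pose K := SubFieldExtType z0 irr; pose rho : K := subfx_root ratr z (f_rat n).
have f0 : f_rat n != 0 by rewrite -size_poly_eq0 size_f_rat.
exists K; exists rho.
  rewrite -(fmorph_root (subfx_inj : {rmorphism K -> algC})) -map_poly_comp /=.
  rewrite /rho subfx_inj_root //; have := z0; rewrite -map_poly_comp.
  by congr (root _ _); apply: eq_map_poly => k /=; rewrite !rmorph_int.
apply/vspaceP => x; rewrite memvf; apply/Fadjoin_polyP.
have [q ->] := subfxEroot z0 f0 x.
exists (map_poly (in_alg K) q) => //.
by apply/polyOver1P; exists q.
Qed.

Section CubicField.
Variables (K : fieldExtType rat) (n : int) (rho : K).
Hypotheses (n0 : n != 0) (rho0 : root (map_poly intr (f_poly n)) rho).
Hypothesis K_gen : <<1; rho>>%VS = fullv.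

Let fK : map_poly intr (f_poly n) = map_poly (in_alg K) (f_rat n).
Proof. by rewrite -map_poly_comp; apply: eq_map_poly => z /=; rewrite scaler_int. Qed.

Lemma root_f_dvd (p : {poly rat}) : (map_poly (in_alg K) p).[rho] = 0 -> f_rat n %| p.
Proof.
move=> px0; rewrite -[_ %| _]negbK -(irreducible_poly_coprime _ (f_irreducible n0)).
apply/negP => /Bezout_eq1_coprimepP[[u v] /= uv].
have := congr1 (fun q => (map_poly (in_alg K) q).[rho]) uv.
rewrite rmorphD !rmorphM rmorph1 /= hornerD !hornerM px0 -fK (rootP rho0) hornerC.
by rewrite !mulr0 addr0 => /eqP; rewrite eq_sym oner_eq0.
Qed.

Lemma poly_of (x : K) : exists p : {poly rat}, x = (map_poly (in_alg K) p).[rho].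
Proof.
have : x \in <<1; rho>>%VS by rewrite K_gen memvf.
by case/Fadjoin_polyP => p /polyOver1P[q ->] ->; exists q.
Qed.

Lemma coords (x : K) : exists a b c : rat, x = a%:A + b%:A * rho + c%:A * rho ^+ 2.
Proof.
have [p ->] := poly_of x; pose q := p %% f_rat n.
have f0 : f_rat n != 0 by rewrite -size_poly_eq0 size_f_rat.
have sq : (size q <= 3)%N by have := ltn_modp p (f_rat n); rewrite f0 size_f_rat.
exists q`_0, q`_1, q`_2.
have -> : (map_poly (in_alg K) p).[rho] = (map_poly (in_alg K) q).[rho].
  rewrite {1}(divp_eq p (f_rat n)) rmorphD rmorphM /= -fK hornerD hornerM.
  by rewrite (rootP rho0) mulr0 add0r.
rewrite (@horner_coef_wide _ 3) ?size_map_poly // !big_ord_recl big_ord0 !coef_map /=.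
by rewrite expr0 mulr1 expr1 addr0 addrA.
Qed.

(** Each element is written as a polynomial in [rho], which is then evaluated at [r]. Two such
    polynomials differ by a multiple of f_n, so the choice does not matter. *)
Lemma embedding (R : fieldType) (ratr_inj : {rmorphism rat -> R}) (r : R) :
    root (map_poly intr (f_poly n)) r ->
  exists s : {rmorphism K -> R}, s rho = r.
Proof.
move=> r0; pose ev p := (map_poly ratr_inj p).[r].
have ev_eq p q : (map_poly (in_alg K) p).[rho] = (map_poly (in_alg K) q).[rho] -> ev p = ev q.
  move=> pq; apply/eqP; rewrite -subr_eq0 /ev -hornerN -hornerD -rmorphB /=.
  have /dvdpP[u ->] : f_rat n %| p - q.
    by apply: root_f_dvd; rewrite rmorphB /= hornerD hornerN pq subrr.
  rewrite rmorphM /= hornerM -[map_poly _ (f_rat n)]map_poly_comp.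
  rewrite (eq_map_poly (g := intr)) ?(rootP r0) ?mulr0 // => z /=.
  by rewrite rmorph_int.
have [P PE] := choice poly_of.
pose s x := ev (P x).
have sE p : s (map_poly (in_alg K) p).[rho] = ev p by apply: ev_eq; rewrite -PE.
have s_add : zmod_morphism s.
  move=> x y; rewrite {1}(PE x) {1}(PE y) -hornerN -hornerD -rmorphB sE.
  by rewrite /ev rmorphB /= hornerD hornerN.
have s_mul : monoid_morphism s.
  split=> [|x y]; last first.
    by rewrite {1}(PE x) {1}(PE y) -hornerM -rmorphM sE /ev rmorphM hornerM.
  have -> : 1 = (map_poly (in_alg K) 1).[rho] by rewrite rmorph1 hornerC.
  by rewrite sE /ev rmorph1 hornerC.
pose sR : {rmorphism K -> R} := HB.pack s (GRing.isZmodMorphism.Build K R s s_add)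
  (GRing.isMonoidMorphism.Build K R s s_mul).
exists sR; have := sE 'X; rewrite map_polyX hornerX /ev map_polyX hornerX.
exact.
Qed.

End CubicField.

(** * Conjugates, characteristic polynomials and discriminants *)

Section Conjugates.
Variables (R : archiRcfType) (K : fieldExtType rat) (n : int) (rho : K).
Hypotheses (n0 : n != 0) (rho0 : root (map_poly intr (f_poly n)) rho).
Hypothesis K_gen : <<1; rho>>%VS = fullv.
Variables (s1 s2 s3 : {rmorphism K -> R}).
Let r1 := s1 rho. Let r2 := s2 rho. Let r3 := s3 rho.
Hypotheses (e1 : r1 + r2 + r3 = - n%:~R)
  (e2 : r1 * r2 + r1 * r3 + r2 * r3 = n%:~R) (e3 : r1 * r2 * r3 = 1).

Lemma rmorph_rat_alg (s : {rmorphism K -> R}) (a : rat) : s a%:A = ratr a.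
Proof. exact: (fmorph_eq_rat (s \o in_alg K)). Qed.

Lemma rmorph_coords (s : {rmorphism K -> R}) (a b c : rat) :
  s (a%:A + b%:A * rho + c%:A * rho ^+ 2)
  = ratr a + ratr b * s rho + ratr c * s rho ^+ 2.
Proof. by rewrite !rmorphD !rmorphM !rmorph_rat_alg. Qed.

Lemma trace_rat (x : K) : exists t : rat, s1 x + s2 x + s3 x = ratr t.
Proof.
have [a [b [c ->]]] := coords rho0 K_gen x.
exists (3 * a - b * n%:~R + c * (n%:~R ^+ 2 - 2 * n%:~R)).
rewrite !rmorph_coords -/r1 -/r2 -/r3.
have -> : ratr a + ratr b * r1 + ratr c * r1 ^+ 2 + (ratr a + ratr b * r2 + ratr c * r2 ^+ 2) +
   (ratr a + ratr b * r3 + ratr c * r3 ^+ 2) = 3 * ratr a + ratr b * (r1 + r2 + r3)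
   + ratr c * ((r1 + r2 + r3) ^+ 2 - 2 * (r1 * r2 + r1 * r3 + r2 * r3)) by ring.
rewrite e1 e2 !(rmorphD, rmorphN, rmorphM, rmorphXn) /= !ratr_int !rmorph1; ring.
Qed.

Lemma rat_int_of_integral (t : rat) : integralOver (intr : int -> R) (ratr t) ->
  exists z : int, ratr t = z%:~R :> R.
Proof.
case=> p mon_p px0; have [|z ->] := @integral_rat_int t; last by exists z; rewrite ratr_int.
exists p => //; rewrite -(fmorph_root (ratr : {rmorphism rat -> R})) -map_poly_comp.
by move: px0; congr (root _ _); apply: eq_map_poly => z /=; rewrite ratr_int.
Qed.

Lemma integral_embed (s : {rmorphism K -> R}) x : ring_of_integers x ->
  integralOver (intr : {rmorphism int -> R}) (s x).
Proof.
case=> p mon_p px0; exists p => //.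
rewrite (_ : map_poly _ _ = map_poly s (map_poly intr p)) ?fmorph_root //.
by rewrite -map_poly_comp; apply: eq_map_poly => z /=; rewrite rmorph_int.
Qed.

(** Newton's identities express the coefficients through the traces of [x], [x ^+ 2] and [x ^+ 3],
    so they are rational; they are also integral, hence integers. *)
Lemma charpoly_int (x : K) : ring_of_integers x -> exists T S N : int,
  [/\ s1 x + s2 x + s3 x = T%:~R, s1 x * s2 x + s1 x * s3 x + s2 x * s3 x = S%:~R
    & s1 x * s2 x * s3 x = N%:~R].
Proof.
move=> Ox.
have [i1 i2 i3] := And3 (integral_embed s1 Ox) (integral_embed s2 Ox) (integral_embed s3 Ox).
have [t1 t1E] := trace_rat x.
have [t2] := trace_rat (x ^+ 2); rewrite !rmorphXn /= => t2E.
have [t3] := trace_rat (x ^+ 3); rewrite !rmorphXn /= => t3E.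
have [T TE] : exists z : int, ratr t1 = z%:~R :> R.
  by apply: rat_int_of_integral; rewrite -t1E; do 2?[apply: integral_add].
have SE : s1 x * s2 x + s1 x * s3 x + s2 x * s3 x = ratr ((t1 ^+ 2 - t2) / 2).
  by rewrite !(rmorphM, rmorphB, rmorphD, fmorphV, rmorph1) /= -t1E -t2E; field.
have NE : s1 x * s2 x * s3 x = ratr ((t1 ^+ 3 - 3 * t1 * t2 + 2 * t3) / 6).
  rewrite !(rmorphM, rmorphB, rmorphD, rmorphXn, fmorphV, rmorph1) /= -t1E -t2E -t3E.
  by field.
have [S S'] : exists z : int, ratr ((t1 ^+ 2 - t2) / 2) = z%:~R :> R.
  by apply: rat_int_of_integral; rewrite -SE; do 2?[apply: integral_add]; apply: integral_mul.
have [N N'] : exists z : int, ratr ((t1 ^+ 3 - 3 * t1 * t2 + 2 * t3) / 6) = z%:~R :> R.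
  by apply: rat_int_of_integral; rewrite -NE; do 2?[apply: integral_mul].
by exists T, S, N; rewrite t1E SE NE.
Qed.

(** By Cayley-Hamilton, an element of norm [N = 1] or [N = -1] has the inverse
    [N * (x ^+ 2 - T * x + S)]. *)
Lemma integersV (x : K) : ring_of_integers x -> `|s1 x * s2 x * s3 x| = 1 ->
  ring_of_integers x^-1.
Proof.
move=> Ox; have [T [S [N [TE SE NE]]]] := charpoly_int Ox.
rewrite NE -intr_norm -[1]/(1%:~R) => /intr_inj N1.
have NN : N * N = 1 by clear -N1; lia.
have [NR TR SR] := And3 (rmorph_int s1 N) (rmorph_int s1 T) (rmorph_int s1 S).
pose y := N%:~R * (x ^+ 2 - T%:~R * x + S%:~R).
have Oy : ring_of_integers y.
  apply: integersM; first exact: integers_int.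
  apply: integersD; last exact: integers_int.
  by apply: integersB; [exact: integersX|apply: integersM => //; exact: integers_int].
suff xy : x * y = 1.
  have x0 : x != 0 by apply: contra_eq_neq xy => ->; rewrite mul0r eq_sym oner_neq0.
  by rewrite (_ : x^-1 = y) //; apply: (mulfI x0); rewrite xy mulfV.
apply: (fmorph_inj s1); rewrite rmorph1 /y !(rmorphM, rmorphD, rmorphN, rmorphXn) /= NR TR SR.
have -> : s1 x * (N%:~R * (s1 x ^+ 2 - T%:~R * s1 x + S%:~R)) = N%:~R * N%:~R :> R.
  by rewrite -{2}NE -TE -SE; ring.
by rewrite -rmorphM NN.
Qed.

(* The discriminant m^4 - 18 m^2 - 27 of f_m. *)
Definition disc (m : int) : int := (m ^+ 2 - 9) ^+ 2 - 108.

(** The Vandermonde product of the conjugates of [x] is a rational multiple [w] of that of the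
    conjugates of [rho]. Squaring, [disc m = w ^+ 2 * disc n], so the rational [w * disc n] has an
    integer square and is an integer. *)
Lemma disc_square (m : int) (x : K) : m != 0 -> root (map_poly intr (f_poly m)) x ->
  exists z : int, z ^+ 2 = disc m * disc n.
Proof.
move=> m0 x0.
have Ox : ring_of_integers x by exists (f_poly m); rewrite ?f_monic.
have [T [S [N [TE SE NE]]]] := charpoly_int Ox.
have fx : x ^+ 3 + m%:~R * x ^+ 2 + m%:~R * x - 1 = 0.
  by rewrite -horner_f; apply/rootP.
(* f_m minus the characteristic polynomial of [x]: it has degree at most 2 and vanishes at [x], so
   it is zero because f_m is irreducible. *)
pose p : {poly rat} := (m%:~R + T%:~R) *: 'X^2 + (m%:~R - S%:~R) *: 'X + (N%:~R%:P - 1).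
have px : (map_poly (in_alg K) p).[x] = 0.
  rewrite /p rmorphD rmorphB rmorph1 rmorphD /= !map_polyZ map_polyXn map_polyX map_polyC.
  rewrite !(hornerD, hornerN, hornerZ, hornerX, hornerXn, hornerC) /=.
  rewrite !(scalerDl, scaleNr, scale1r) !scaler_int.
  apply: (fmorph_inj s1); have := congr1 s1 fx.
  rewrite !(rmorph0, rmorphD, rmorphN, rmorphM, rmorphXn, rmorph1, rmorph_int) /=.
  by rewrite -TE -SE -NE => <-; ring.
have /eqP p0 : p == 0.
  apply: contraT => pn0; have := dvdp_leq pn0 (root_f_dvd m0 x0 px).
  rewrite size_f_rat ltnNge /p; case/negP.
  apply: leq_trans (size_polyD _ _) _; rewrite geq_max; apply/andP; split; last first.
    by rewrite -polyCB; apply: leq_trans (size_polyC_leq1 _) _.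
  apply: leq_trans (size_polyD _ _) _; rewrite geq_max; apply/andP; split.
    by apply: leq_trans (size_scale_leq _ _) _; rewrite size_polyXn.
  by apply: leq_trans (size_scale_leq _ _) _; rewrite size_polyX.
have co k : p`_k = 0 by rewrite p0 coef0.
have [TM SM NM] : [/\ T = - m, S = m & N = 1].
  move: (co 2%N) (co 1%N) (co 0%N).
  rewrite /p -polyCB !coefD !coefZ !coefXn !coefX !coefC /= !(mulr0, mulr1, addr0, add0r).
  move=> /eqP + /eqP + /eqP; rewrite addr_eq0 !subr_eq0 -rmorphN -[1]/(1%:~R) !eqr_int.
  by move=> /eqP ? /eqP ? /eqP ?; split; lia.
rewrite {}TM {}SM {}NM in TE SE NE.
have [a [b [c xE]]] := coords rho0 K_gen x.
(* [s1 x - s2 x] is [r1 - r2] times [b + c * (r1 + r2) = B - c * r3], and likewise for the other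
   pairs; [w] is the product of the three [B - c * ri]. *)
pose B := b - c * n%:~R.
pose w : rat := B ^+ 3 + c * n%:~R * B ^+ 2 + c ^+ 2 * n%:~R * B - c ^+ 3.
have [x1E x2E x3E] : [/\ s1 x = ratr a + ratr b * r1 + ratr c * r1 ^+ 2,
    s2 x = ratr a + ratr b * r2 + ratr c * r2 ^+ 2
  & s3 x = ratr a + ratr b * r3 + ratr c * r3 ^+ 2] by rewrite xE !rmorph_coords.
pose V (u1 u2 u3 : R) := (u1 - u2) * (u1 - u3) * (u2 - u3).
have VE u1 u2 u3 : V u1 u2 u3 ^+ 2 = (u1 + u2 + u3) ^+ 2 * (u1 * u2 + u1 * u3 + u2 * u3) ^+ 2
   - 4 * (u1 * u2 + u1 * u3 + u2 * u3) ^+ 3 - 4 * (u1 + u2 + u3) ^+ 3 * (u1 * u2 * u3)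
   + 18 * (u1 + u2 + u3) * (u1 * u2 + u1 * u3 + u2 * u3) * (u1 * u2 * u3)
   - 27 * (u1 * u2 * u3) ^+ 2 by rewrite /V; ring.
have dn : V r1 r2 r3 ^+ 2 = (disc n)%:~R.
  by rewrite VE e1 e2 e3 /disc !(rmorphB, rmorphXn) /=; ring.
have dm : V (s1 x) (s2 x) (s3 x) ^+ 2 = (disc m)%:~R.
  by rewrite VE TE SE NE /disc !(rmorphB, rmorphXn, rmorphN) /=; ring.
have Vw : V (s1 x) (s2 x) (s3 x) = ratr w * V r1 r2 r3.
  pose B' : R := ratr b + ratr c * (r1 + r2 + r3).
  have -> : ratr w = B' ^+ 3 - ratr c * (r1 + r2 + r3) * B' ^+ 2
     + ratr c ^+ 2 * (r1 * r2 + r1 * r3 + r2 * r3) * B' - ratr c ^+ 3 * (r1 * r2 * r3).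
    rewrite /B' e1 e2 e3 /w /B !(rmorphB, rmorphD, rmorphM, rmorphXn) /= !ratr_int; ring.
  by rewrite x1E x2E x3E /V /B'; ring.
have sq : (w * (disc n)%:~R) ^+ 2 = (disc m * disc n)%:~R.
  apply: (fmorph_inj (ratr : {rmorphism rat -> R})).
  rewrite rmorphXn rmorphM /= !ratr_int rmorphM /= -dm -dn Vw; ring.
have [|z zE] := @integral_rat_int (w * (disc n)%:~R).
  exists ('X^2 - (disc m * disc n)%:P).
    by rewrite monicE lead_coefDl ?lead_coefXn // size_polyXn size_polyN ltnS
      (leq_trans (size_polyC_leq1 _)).
  rewrite /root rmorphB /= map_polyXn map_polyC !(hornerD, hornerN, hornerXn, hornerC) sq.
  by rewrite subrr.
by exists z; apply: (@intr_inj rat); rewrite rmorphXn /= -zE.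
Qed.

End Conjugates.

(** * Units *)

(** The roots are found by sign changes near 0, -1 and -n. Vieta's relations then follow from the
    divided differences of f_n at pairs of distinct roots. *)
Lemma real_roots (R : rcfType) (n : int) : 100 <= n -> exists r1 r2 r3 : R,
  [/\ root (map_poly intr (f_poly n)) r1, root (map_poly intr (f_poly n)) r2,
      root (map_poly intr (f_poly n)) r3
    & [/\ r1 + r2 + r3 = - n%:~R, r1 * r2 + r1 * r3 + r2 * r3 = n%:~R & r1 * r2 * r3 = 1] /\
      [/\ 0 < r1 <= n%:~R^-1, - 8 / n%:~R <= r2 + 1 < 0 & - n%:~R <= r3 <= - n%:~R + 2]].
Proof.
move=> n100; set F := map_poly _ _.
have : 100 <= n%:~R :> R by rewrite (ler_int R 100).
set k : R := n%:~R => k100.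
have FE x : F.[x] = x ^+ 3 + k * x ^+ 2 + k * x - 1 by exact: horner_f.
have k0 : 0 < k by lra.
have kV : k * k^-1 = 1 by rewrite mulfV // gt_eqF.
have kV0 : 0 < k^-1 by rewrite invr_gt0.
have kV1 : k^-1 <= 1 / 100 by rewrite div1r lef_pV2 ?posrE.
have [||r1 /andP[r1_0 r1_1] F1] := @poly_ivt R F 0 k^-1; first exact: ltW.
  rewrite !FE !expr0n /= !mulr0 !add0r oppr_le0 ler01 /=.
  have -> : k^-1 ^+ 3 + k * k^-1 ^+ 2 + k * k^-1 - 1
    = k^-1 ^+ 3 + (k * k^-1) * k^-1 + (k * k^-1) - 1 by ring.
  by rewrite kV mul1r addrK addr_ge0 ?exprn_ge0 // ltW.
(* f_n takes the value -2 at -1, with slope about -n, so that a displacement of 8 / n is ample to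
   change the sign. *)
have [||r2' /andP[r2_0 r2_1] F2] := @poly_ivt R (- F) (- 1 - 8 / k) (- 1).
- by rewrite gerBl mulr_ge0 // ltW.
- rewrite !hornerN !FE oppr_le0 oppr_ge0; apply/andP; split; last by lra.
  pose z := k^-1; rewrite -/z in kV kV0 kV1 *.
  have -> : (- 1 - 8 * z) ^+ 3 + k * (- 1 - 8 * z) ^+ 2 + k * (-1 - 8 * z) - 1 =
    -2 + 8 * (k * z) + 64 * (k * z) * z - 24 * z - 192 * z ^+ 2 - 512 * z ^+ 3 by ring.
  rewrite kV; have : z ^+ 2 <= z / 100 by rewrite expr2 ler_wpM2l //; lra.
  have : z ^+ 3 <= z / 100.
    rewrite exprS ler_wpM2l ?(ltW kV0) // expr2 -[leRHS]mulr1.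
    by apply: ler_pM; lra.
  lra.
rewrite rootN in F2.
have [||r3 /andP[r3_0 r3_1] F3] := @poly_ivt R F (- k) (- k + 2); first by lra.
  rewrite !FE; apply/andP; split; last first.
    by rewrite (_ : _ - 1 = (k - 6) * k + 7); [apply: addr_ge0 => //; apply: mulr_ge0; lra|ring].
  by rewrite (_ : _ - 1 = - (k ^+ 2 + 1)); [rewrite oppr_le0 addr_ge0 // exprn_ge0 // ltW|ring].
have q x y : x != y -> root F x -> root F y -> x ^+ 2 + x * y + y ^+ 2 + k * (x + y) + k = 0.
  move=> xy /rootP + /rootP; rewrite !FE => x0 y0; apply: (mulfI (x := x - y)).
    by rewrite subr_eq0.
  by rewrite mulr0 -[RHS](subrr 0) -{1}x0 -y0; ring.
have n12 : r1 != r2' by apply: contraTneq r1_0 => ->; rewrite -ltNge; lra.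
have n13 : r1 != r3 by apply: contraTneq r1_0 => ->; rewrite -ltNge; lra.
have n23 : r2' != r3.
  apply: contraTneq r2_0 => ->; rewrite -ltNge; lra.
have q12 := q _ _ n12 F1 F2; have q13 := q _ _ n13 F1 F3.
have e1 : r1 + r2' + r3 = - k.
  apply/eqP; rewrite -addr_eq0; apply/eqP; apply: (mulfI (x := r2' - r3)).
    by rewrite subr_eq0.
  by rewrite mulr0 -[RHS](subrr 0) -{1}q12 -q13; ring.
have e2 : r1 * r2' + r1 * r3 + r2' * r3 = k.
  have r3E : r3 = - k - r1 - r2' by rewrite -e1; ring.
  by rewrite r3E -[RHS]subr0 -q12; ring.
have e3 : r1 * r2' * r3 = 1.
  have r3E : r3 = - k - r1 - r2' by rewrite -e1; ring.
  have /rootP := F1; rewrite FE => F1'.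
  apply/eqP; rewrite -subr_eq0 -[X in _ == X]F1' r3E.
  have -> : r1 * r2' * (- k - r1 - r2') - 1 = r1 ^+ 3 + k * r1 ^+ 2 + k * r1 - 1
    - r1 * (r1 ^+ 2 + r1 * r2' + r2' ^+ 2 + k * (r1 + r2') + k) by ring.
  by rewrite q12 mulr0 subr0.
exists r1, r2', r3; split=> //; split=> //; split.
- rewrite lt_def r1_0 r1_1 !andbT; apply: contra_eq_neq e3 => ->.
  by rewrite !mul0r eq_sym oner_neq0.
- rewrite -lerBlDr; apply/andP; split; first by lra.
  have : r2' != -1.
    apply/eqP => r2E; have /rootP := F2; rewrite FE r2E; lra.
  by move=> n1; rewrite -ltrBrDr sub0r lt_neqAle n1.
- by rewrite r3_0 r3_1.
Qed.

Lemma exists_conjugates (R : archiRcfType) (K : fieldExtType rat) (n : int) (rho : K) :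
    100 <= n -> root (map_poly intr (f_poly n)) rho -> <<1; rho>>%VS = fullv ->
  exists s1 s2 s3 : {rmorphism K -> R},
    [/\ s1 rho + s2 rho + s3 rho = - n%:~R,
      s1 rho * s2 rho + s1 rho * s3 rho + s2 rho * s3 rho = n%:~R
      & s1 rho * s2 rho * s3 rho = 1] /\
    [/\ 0 < s1 rho <= n%:~R^-1, - 8 / n%:~R <= s2 rho + 1 < 0
      & - n%:~R <= s3 rho <= - n%:~R + 2].
Proof.
move=> n100 rho0 K_gen; have n0 : n != 0 by apply: contraTneq n100 => ->.
have [r1 [r2 [r3 [F1 F2 F3 bnds]]]] := real_roots R n100.
have [s1 s1E] := embedding n0 rho0 K_gen (ratr : {rmorphism rat -> R}) F1.
have [s2 s2E] := embedding n0 rho0 K_gen (ratr : {rmorphism rat -> R}) F2.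
have [s3 s3E] := embedding n0 rho0 K_gen (ratr : {rmorphism rat -> R}) F3.
by exists s1, s2, s3; rewrite s1E s2E s3E.
Qed.

(** The count behind [dirichlet]: the [N ^ 3] exponent vectors outnumber [F] times the cells, whose
    number grows only like [N ^ 2]. *)
Lemma pigeon_count (B F N : nat) : N = ((6 * B).+1 ^ 2 * F).+1 ->
  ((3 * B * N + 3 * B * N).+1 * (3 * B * N + 3 * B * N).+1 * F < N * N * N)%N.
Proof.
set a := (6 * B).+1; set D := (3 * B * N)%N => NE.
have N0 : (0 < N)%N by rewrite NE.
have Da : ((D + D).+1 <= a * N)%N.
  by rewrite /a mulSn addnC -addn1 leq_add // /D -mulnDl -mulnDl.
apply: leq_ltn_trans (leq_mul (leq_mul Da Da) (leqnn F)) _.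
have -> : (a * N * (a * N) * F = N * N * (a ^ 2 * F))%N by rewrite expnS expn1; lia.
by rewrite ltn_pmul2l ?muln_gt0 ?N0 // NE.
Qed.

Section Dirichlet.
Variables (R : archiRcfType) (K : fieldExtType rat) (n : int) (rho : K).
Hypotheses (n0 : n != 0) (rho0 : root (map_poly intr (f_poly n)) rho).
Hypothesis K_gen : <<1; rho>>%VS = fullv.
Variables (s1 s2 s3 : {rmorphism K -> R}).
Let r1 := s1 rho. Let r2 := s2 rho. Let r3 := s3 rho.
Hypotheses (e1 : r1 + r2 + r3 = - n%:~R)
  (e2 : r1 * r2 + r1 * r3 + r2 * r3 = n%:~R) (e3 : r1 * r2 * r3 = 1).

Let charpoly := charpoly_int rho0 K_gen e1 e2.

Definition integer_unit (x : K) :=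
  [/\ x != 0, ring_of_integers x & ring_of_integers x^-1].

Lemma integer_unitM x y : integer_unit x -> integer_unit y -> integer_unit (x * y).
Proof.
move=> [x0 Ox OVx] [y0 Oy OVy]; split; first by rewrite mulf_neq0.
  exact: integersM.
by rewrite invfM; apply: integersM.
Qed.

Lemma integer_unitV x : integer_unit x -> integer_unit x^-1.
Proof. by move=> [x0 Ox OVx]; split; rewrite ?invr_eq0 ?invrK. Qed.

Lemma integer_unitX x k : integer_unit x -> integer_unit (x ^+ k).
Proof.
move=> [x0 Ox OVx]; split; first by rewrite expf_neq0.
  exact: integersX.
by rewrite -exprVn; apply: integersX.
Qed.

Lemma unit_norm x : integer_unit x -> `|s1 x| * `|s2 x| * `|s3 x| = 1.
Proof.
move=> [x0 Ox OVx]; have [_ [_ [N [_ _ NE]]]] := charpoly Ox.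
have [_ [_ [M [_ _ ME]]]] := charpoly OVx.
have NM : N * M = 1.
  apply: (@intr_inj R); rewrite rmorphM /= -NE -ME !fmorphV.
  by field; rewrite !fmorph_eq0 x0.
rewrite -!normrM NE -intr_norm.
have : (`|N| * `|M| == 1)%N by rewrite -abszM NM.
by rewrite muln_eq1 -abszE => /andP[/eqP-> _].
Qed.

Lemma roots_in_seq (p : {poly K}) : p != 0 -> exists rs : seq K, forall x, root p x -> x \in rs.
Proof.
elim: {p}_.+1 {-2}p (ltnSn (size p)) => // k IH p sp p0.
have [[x px]|npx] := pselect (exists x, root p x); last first.
  by exists [::] => x px; case: npx; exists x.
have /factor_theorem[q qE] := px.
have q0 : q != 0 by apply: contra_neq p0 => q0; rewrite qE q0 mul0r.
have [|rs rsP] := IH q _ q0.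
  by move: sp; rewrite qE size_Mmonic ?monicXsubC // size_XsubC addnC.
exists (x :: rs) => y; rewrite qE rootM root_XsubC inE orbC => /orP[->//|/rsP ->].
by rewrite orbT.
Qed.

(** Having norm 1 up to sign bounds the third conjugate by 4, so the characteristic polynomial has
    integer coefficients of absolute value at most 20. There are finitely many such cubics, each
    with finitely many roots. *)
Lemma bounded_units : exists W : seq K, forall w, integer_unit w ->
  1 / 2 <= `|s1 w| <= 2 -> 1 / 2 <= `|s2 w| <= 2 -> w \in W.
Proof.
pose I : finType := ('I_41 * 'I_41 * 'I_41)%type.
pose P (i : I) : {poly K} := 'X^3 + (- ((i.1.1 : nat)%:Z - 20)%:~R *: 'X^2
  + (((i.1.2 : nat)%:Z - 20)%:~R *: 'X - ((i.2 : nat)%:Z - 20)%:~R%:P)).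
have P0 i : P i != 0.
  apply: monic_neq0; rewrite monicE lead_coefDl ?lead_coefXn // size_polyXn ltnS.
  apply: leq_trans (size_polyD _ _) _; rewrite geq_max; apply/andP; split.
    by apply: leq_trans (size_scale_leq _ _) _; rewrite size_polyXn.
  apply: leq_trans (size_polyD _ _) _; rewrite geq_max; apply/andP; split.
    by apply: leq_trans (size_scale_leq _ _) _; rewrite size_polyX.
  by rewrite size_polyN; apply: leq_trans (size_polyC_leq1 _) _.
have [rs rsP] := choice (fun i => roots_in_seq (P0 i)).
exists (flatten [seq rs i | i <- enum I]) => w wU /andP[a1 a2] /andP[b1 b2].
have [w0 Ow _] := wU; have [T [S [N [TE SE NE]]]] := charpoly Ow.
have nrm := unit_norm wU.
have c2 : `|s3 w| <= 4.
  have ab : 1 / 2 * (1 / 2) <= `|s1 w| * `|s2 w| by apply: ler_pM => //; lra.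
  have : 1 / 2 * (1 / 2) * `|s3 w| <= `|s1 w| * `|s2 w| * `|s3 w| by rewrite ler_wpM2r.
  rewrite nrm; lra.
have T20 : `|T| <= 20.
  rewrite -(ler_int R) intr_norm -TE.
  apply: le_trans (ler_normD _ _) _; apply: le_trans (lerD (ler_normD _ _) (lexx _)) _.
  lra.
have S20 : `|S| <= 20.
  rewrite -(ler_int R) intr_norm -SE.
  apply: le_trans (ler_normD _ _) _; apply: le_trans (lerD (ler_normD _ _) (lexx _)) _.
  rewrite !normrM.
  have p1 : `|s1 w| * `|s2 w| <= 2 * 2 by apply: ler_pM.
  have p2 : `|s1 w| * `|s3 w| <= 2 * 4 by apply: ler_pM.
  have p3 : `|s2 w| * `|s3 w| <= 2 * 4 by apply: ler_pM.
  lra.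
have N20 : `|N| <= 20.
  by rewrite -(ler_int R) intr_norm -NE !normrM nrm (ler_nat R 1 20).
have ord (z : int) : `|z| <= 20 -> exists i : 'I_41, (i : nat)%:Z - 20 = z.
  move=> z20; have zlt : (`|(z + 20)%R| < 41)%N by lia.
  by exists (Ordinal zlt) => /=; lia.
have [[i1 E1] [i2 E2] [i3 E3]] := And3 (ord T T20) (ord S S20) (ord N N20).
apply/flattenP; exists (rs (i1, i2, i3)).
  by apply: map_f; rewrite mem_enum.
apply: rsP; rewrite /P /= E1 E2 E3.
apply/rootP; rewrite !(hornerD, hornerN, hornerZ, hornerX, hornerXn, hornerC).
apply: (fmorph_inj s1); rewrite !(rmorph0, rmorphD, rmorphN, rmorphM, rmorphXn, rmorph_int) /=.
by rewrite -TE -SE -NE; ring.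
Qed.

Lemma dyadic (a : R) (M : nat) : 1 <= a -> a <= 2 ^+ M ->
  exists c : 'I_M.+1, 2 ^+ c <= a <= 2 ^+ c.+1.
Proof.
move=> a1 aM; have ex : exists c, (2 ^+ c <= a) by exists 0%N.
have ub c : (2 ^+ c <= a) -> (c <= M)%N.
  move=> ca; have := le_trans ca aM; rewrite ler_eXn2l // ltr1n //.
case: (ex_maxnP ex ub) => c ca cmax; exists (Ordinal (ub c ca : (c < M.+1)%N)).
rewrite ca /= leNgt; apply/negP => /ltW /cmax; by rewrite ltnn.
Qed.

Definition within (B : nat) (a : R) := a <= 2 ^+ B /\ 1 <= a * 2 ^+ B.

Lemma within_leq B B' a : (B <= B')%N -> 0 <= a -> within B a -> within B' a.
Proof.
move=> BB' a0 [aB Ba]; have le2 : 2 ^+ B <= 2 ^+ B' :> R by rewrite ler_weXn2l // ler1n.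
by split; [exact: le_trans aB le2|apply: le_trans Ba _; rewrite ler_wpM2l].
Qed.

Lemma withinM B B' a a' : 0 <= a -> 0 <= a' -> within B a -> within B' a' -> within (B + B') (a * a').
Proof.
move=> a0 a'0 [aB Ba] [aB' Ba']; rewrite /within exprD; split; first exact: ler_pM.
by rewrite mulrACA -[leLHS]mulr1; apply: ler_pM.
Qed.

Lemma withinX B a k : 0 <= a -> within B a -> within (B * k) (a ^+ k).
Proof.
move=> a0 aB; elim: k => [|k IH]; first by rewrite muln0 /within !expr0 mulr1.
by rewrite mulnS exprS; apply: withinM => //; rewrite exprn_ge0.
Qed.

Lemma exists_within (a : R) : 0 < a -> exists B, within B a.
Proof.
move=> a0; pose B := maxn (Num.bound a) (Num.bound a^-1).
have bnd (b : R) : 0 < b -> (Num.bound b <= B)%N -> b <= 2 ^+ B.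
  move=> b0 bB; apply: ltW; apply: lt_le_trans (archi_boundP (ltW b0)) _.
  by rewrite -natrX ler_nat (leq_trans bB) // ltnW // ltn_expl.
exists B; split; first by rewrite bnd // leq_maxl.
by rewrite -ler_pdivrMl // mulr1 bnd ?invr_gt0 // leq_maxr.
Qed.

(** The monomials with exponents below [N] are sorted by their dyadic sizes at two places. Some cell
    gets more than [size W] of them; divided by one member of the cell they all land in [W], so two
    monomials coincide. *)
Lemma dirichlet (u1 u2 u3 : K) :
    integer_unit u1 -> integer_unit u2 -> integer_unit u3 ->
  exists a b c : int, ~ [/\ a = 0, b = 0 & c = 0] /\ u1 ^ a * u2 ^ b * u3 ^ c = 1.
Proof.
move=> U1 U2 U3; have [W WP] := bounded_units.
have [B BP] : exists B : nat, forall s u, s \in [:: 0; 1]%N -> u \in [:: u1; u2; u3] ->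
    within B `|(if s == 0%N then s1 else s2) u|.
  have wi (s : {rmorphism K -> R}) u : integer_unit u -> exists B, within B `|s u|.
    by move=> [u0 _ _]; apply: exists_within; rewrite normr_gt0 fmorph_eq0.
  have [[B1 P1] [B2 P2] [B3 P3]] := And3 (wi s1 _ U1) (wi s1 _ U2) (wi s1 _ U3).
  have [[B4 P4] [B5 P5] [B6 P6]] := And3 (wi s2 _ U1) (wi s2 _ U2) (wi s2 _ U3).
  exists (B1 + B2 + B3 + B4 + B5 + B6)%N => s u.
  rewrite !inE => /orP[] /eqP-> /or3P[] /eqP->; rewrite /=.
  - by apply: within_leq P1; rewrite -?addnA ?leq_addr.
  - by apply: within_leq P2 => //; lia.
  - by apply: within_leq P3 => //; lia.
  - by apply: within_leq P4 => //; lia.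
  - by apply: within_leq P5 => //; lia.
  - by apply: within_leq P6 => //; lia.
pose N := ((6 * B).+1 ^ 2 * size W).+1.
pose T : finType := ('I_N * 'I_N * 'I_N)%type.
pose m (e : T) := u1 ^+ e.1.1 * u2 ^+ e.1.2 * u3 ^+ e.2.
have mU e : integer_unit (m e) by do 2?[apply: integer_unitM]; apply: integer_unitX.
have [/injectiveP minj|/injectivePn[e [e' ee' mee']]] := boolP (injectiveb m); last first.
  exists (e.1.1%:Z - e'.1.1%:Z), (e.1.2%:Z - e'.1.2%:Z), (e.2%:Z - e'.2%:Z); split.
    move=> [E1 E2 E3]; case/eqP: ee'; move: E1 E2 E3 {mee'}.
    case: e => [[x1 x2] x3]; case: e' => [[y1 y2] y3] /= E1 E2 E3.
    by congr (_, _, _); apply: val_inj => /=; lia.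
  have [[u10 _ _] [u20 _ _] [u30 _ _]] := And3 U1 U2 U3.
  rewrite !expfzDr // -!invr_expz -!exprnP.
  have -> : u1 ^+ e.1.1 * (u1 ^+ e'.1.1)^-1 * (u2 ^+ e.1.2 * (u2 ^+ e'.1.2)^-1)
    * (u3 ^+ e.2 * (u3 ^+ e'.2)^-1) = m e / m e'.
    by rewrite /m !invfM; ring.
  by rewrite mee' divff //; case: (mU e').
pose D := (3 * B * N)%N.
(* The factor [2 ^+ D] moves the sizes into the range from 1 to [2 ^+ (D + D)], where the dyadic
   index is a natural number. *)
have cell_ex (s : nat) (e : T) : s \in [:: 0; 1]%N -> exists c : 'I_(D + D).+1,
    2 ^+ c <= `|(if s == 0%N then s1 else s2) (m e)| * 2 ^+ D <= 2 ^+ c.+1.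
  move=> s01; set sg := if _ then _ else _.
  have wX u (k : 'I_N) : u \in [:: u1; u2; u3] -> within (B * N) `|sg (u ^+ k)|.
    move=> uu; rewrite rmorphXn normrX; apply: within_leq (withinX _ _ (BP s u s01 uu)) => //.
      by rewrite leq_mul2l ltnW ?orbT.
    by rewrite exprn_ge0.
  have wm : within D `|sg (m e)|.
    rewrite /m !rmorphM !normrM /D (_ : 3 * B * N = B * N + B * N + B * N)%N; last by lia.
    by do 2?[apply: withinM; rewrite ?mulr_ge0 //]; apply: wX; rewrite !inE eqxx ?orbT.
  case: wm => w1 w2; apply: dyadic => //.
  by rewrite exprD ler_wpM2r // exprn_ge0.
have [c1 c1P] := choice (fun e => cell_ex 0%N e isT).
have [c2 c2P] := choice (fun e => cell_ex 1%N e isT).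
rewrite /= in c1P c2P.
pose cell e := (c1 e, c2 e).
have [cc big_cc] : exists cc, (size W < #|[pred e | cell e == cc]|)%N.
  apply: contrapT => nb.
  have : (#|T| <= \sum_(cc : 'I_(D + D).+1 * 'I_(D + D).+1) size W)%N.
    rewrite -sum1_card (partition_big cell predT) //=.
    apply: leq_sum => cc _; rewrite sum1dep_card leqNgt; apply/negP => lt; apply: nb.
    by exists cc; apply: leq_trans lt _; apply/subset_leq_card/fintype.subsetP => e; rewrite !inE.
  rewrite sum_nat_const !card_prod !card_ord leqNgt => /negP; apply.
  exact: pigeon_count (erefl N).
have [e0 e0cc] : exists e0, cell e0 == cc.
  by have /card_gt0P[e0] := leq_ltn_trans (leq0n _) big_cc; exists e0.
have cellP (s : {rmorphism K -> R}) (c : T -> 'I_(D + D).+1) e :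
   (forall e, 2 ^+ c e <= `|s (m e)| * 2 ^+ D <= 2 ^+ (c e).+1) -> c e = c e0 ->
   1 / 2 <= `|s (m e / m e0)| <= 2.
  move=> cP ce; have := cP e; rewrite ce => /andP[a1 a2]; have /andP[b1 b2] := cP e0.
  have D0 : 0 < 2 ^+ D :> R by rewrite exprn_gt0.
  have m0 : 0 < `|s (m e0)| by rewrite normr_gt0 fmorph_eq0; case: (mU e0).
  rewrite rmorphM fmorphV normrM normfV ler_pdivlMr // ler_pdivrMr //.
  move: a1 a2 b1 b2; rewrite !exprS; move: (2 ^+ c e0) (2 ^+ D) D0 => x y y0 a1 a2 b1 b2.
  by rewrite -(ler_pM2r y0) -[X in _ && X](ler_pM2r y0); apply/andP; split; lra.
have : (size [seq m e / m e0 | e in [pred e | cell e == cc]] <= size W)%N.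
  apply: uniq_leq_size.
    rewrite map_inj_uniq ?enum_uniq // => e e' /= /(congr1 ( *%R^~ (m e0))).
    by rewrite !divfK; [exact: minj|case: (mU e0)..].
  move=> w /mapP[e]; rewrite mem_enum inE => /eqP ecc ->; move/eqP: e0cc => e0cc.
  have [ce1 ce2] : c1 e = c1 e0 /\ c2 e = c2 e0.
    by move: ecc; rewrite -e0cc => -[].
  apply: WP; first by apply: integer_unitM => //; apply: integer_unitV.
    exact: (cellP s1 c1 e c1P ce1).
  exact: (cellP s2 c2 e c2P ce2).
by rewrite size_image leqNgt big_cc.
Qed.

(** A field with a real embedding has no roots of unity besides 1 and -1. *)
Lemma torsion_sign p (w : K) : (0 < p)%N -> w ^+ p = 1 \/ w ^+ p = -1 -> w = 1 \/ w = -1.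
Proof.
move=> p0 wp; have w1 : `|s1 w| ^+ p = 1.
  by rewrite -normrX -rmorphXn; case: wp => ->; rewrite ?rmorphN rmorph1 ?normrN normr1.
have /eqP : `|s1 w| == 1 by rewrite -(pexpr_eq1 p0) ?w1.
move/eqP; rewrite eqr_norml ler01 andbT => /orP[] /eqP sw; [left|right];
  by apply: (fmorph_inj s1); rewrite sw ?rmorphN rmorph1.
Qed.

(** Descent on the total size of the exponents: if [p] divides all of them, the relation with
    divided exponents still holds up to sign by [torsion_sign]. *)
Lemma dirichlet_mod (p : nat) (u1 u2 u3 : K) : prime p ->
    integer_unit u1 -> integer_unit u2 -> integer_unit u3 ->
  exists a b c : int, ~~ [&& (p %| a)%Z, (p %| b)%Z & (p %| c)%Z] /\
    (u1 ^ a * u2 ^ b * u3 ^ c = 1 \/ u1 ^ a * u2 ^ b * u3 ^ c = - 1).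
Proof.
move=> pp U1 U2 U3; have [a [b [c [nz rel]]]] := dirichlet U1 U2 U3.
have {rel} : u1 ^ a * u2 ^ b * u3 ^ c = 1 \/ u1 ^ a * u2 ^ b * u3 ^ c = - 1 by left.
elim: {a b c}_.+1 {-2}a {-2}b {-2}c (ltnSn (`|a| + `|b| + `|c|)) nz => // k IH a b c lek nz rel.
have [/and3P[/dvdzP[a' aE] /dvdzP[b' bE] /dvdzP[c' cE]]|nd] :=
  boolP [&& (p %| a)%Z, (p %| b)%Z & (p %| c)%Z]; last by exists a, b, c.
have p1 := prime_gt1 pp.
apply: (IH a' b' c').
- rewrite -ltnS; apply: leq_trans lek; rewrite aE bE cE !abszM /= ltnS.
  have : (0 < `|a'| + `|b'| + `|c'|)%N.
    rewrite lt0n; apply/eqP => z0; apply: nz; rewrite aE bE cE.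
    by split; lia.
  nia.
- by move=> [a0 b0 c0]; apply: nz; rewrite aE bE cE a0 b0 c0 !mul0r.
- apply: (torsion_sign (prime_gt0 pp)).
  by rewrite !exprMn !exprnP !exprz_exp -aE -bE -cE.
Qed.

End Dirichlet.

(** * An ideal class of order r *)

Section RootIdeal.
Local Open Scope classical_set_scope.
Variables (K : fieldExtType rat) (r : nat) (y g d A B : K).
Hypotheses (r0 : (0 < r)%N) (g0 : g != 0) (Oy : ring_of_integers y)
  (Og : ring_of_integers g) (Od : ring_of_integers d) (OA : ring_of_integers A)
  (OB : ring_of_integers B).
Hypotheses (gd : g * d = y ^+ r) (cop : A * d + B * g = 1).
Notation OK := (@ring_of_integers K).

(** The ideal generated by [y ^+ k] and [g]; for [k <= r] it is the [k]-th power of the ideal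
    generated by [y] and [g]. *)
Definition root_ideal (k : nat) : set K :=
  [set x | exists a b, [/\ OK a, OK b & x = y ^+ k * a + g * b]].

Lemma fractional_root_ideal k : fractional_ideal (root_ideal k).
Proof.
split; last first.
  exists 1; split; [exact: oner_neq0 | exact: integers1 |].
  move=> _ [a [b [Oa Ob ->]]]; rewrite mul1r.
  by apply: integersD; apply: integersM => //; apply: integersX.
split.
- by exists 0, 0; split; rewrite ?mulr0 ?addr0 //; apply: integers0.
- move=> _ _ [a [b [Oa Ob ->]]] [a' [b' [Oa' Ob' ->]]].
  by exists (a + a'), (b + b'); split; [exact: integersD..|ring].
- move=> z _ Oz [a [b [Oa Ob ->]]].
  by exists (z * a), (z * b); split; [exact: integersM..|ring].
Qed.

Lemma fractional_principal (a : K) : a != 0 -> OK a -> fractional_ideal (principal_ideal a^-1).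
Proof.
move=> a0 Oa; split.
  split.
  - by exists 0; rewrite ?mulr0 //; apply: integers0.
  - move=> _ _ [u Ou <-] [v Ov <-]; exists (u + v); last by rewrite mulrDr.
    exact: integersD.
  - move=> z _ Oz [u Ou <-]; exists (z * u); last by rewrite mulrCA.
    exact: integersM.
by exists a; split=> // _ [u Ou <-]; rewrite mulVKf.
Qed.

Lemma root_ideal0 : root_ideal 0 = OK.
Proof.
apply/seteqP; split=> [_ [a [b [Oa Ob ->]]]|x Ox].
  by rewrite expr0 mul1r; apply: integersD => //; apply: integersM.
by exists x, 0; split; [|exact: integers0|rewrite expr0 mul1r mulr0 addr0].
Qed.

Lemma root_ideal_r : root_ideal r = principal_ideal g.
Proof.
apply/seteqP; split=> [_ [a [b [Oa Ob ->]]]|_ [x Ox <-]].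
  exists (d * a + b); last by rewrite -gd; ring.
  by apply: integersD => //; apply: integersM.
by exists 0, x; split; [exact: integers0| |rewrite mulr0 add0r].
Qed.

(** To see that [g] lies in the product, write [g = A * g * d + B * g ^+ 2 = A * y ^+ r + B * g ^+
    2] and split [y ^+ r] as a multiple of [y ^+ k * y]. *)
Lemma root_idealS k : (k < r)%N ->
  ideal_mul (root_ideal 1) (root_ideal k) = root_ideal k.+1.
Proof.
move=> kr; rewrite ideal_mulC; apply/seteqP; split.
  have [[z0 zD zM] _] := fractional_root_ideal k.+1.
  apply: ideal_mul_min => // _ _ [a [b [Oa Ob ->]]] [a' [b' [Oa' Ob' ->]]].
  exists (a * a'), (b * (y ^+ 1 * a' + g * b') + y ^+ k * a * b'); split.
  - exact: integersM.
  - apply: integersD; last by apply: integersM => //; apply: integersM => //; exact: integersX.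
    apply: integersM => //; apply: integersD; apply: integersM => //.
  - by rewrite [y ^+ k.+1]exprSr expr1; ring.
move=> _ [a [b [Oa Ob ->]]].
have -> : y ^+ k.+1 * a + g * b
    = (y ^+ k * (a + A * b * y ^+ (r - k.+1)) + g * 0) * (y ^+ 1 * 1 + g * 0)
      + (y ^+ k * 0 + g * (B * b)) * (y ^+ 1 * 0 + g * 1).
  have yr : y ^+ r = y ^+ k * y ^+ (r - k.+1) * y by rewrite -exprD -exprSr; congr (_ ^+ _); lia.
  have gb : g * b = g * d * A * b + B * g * g * b by rewrite -[LHS]mulr1 -cop; ring.
  by rewrite gb gd yr exprSr; ring.
have [O0 O1] := (@integers0 K, @integers1 K).
have OX := integersX.
by apply: ideal_mulD; apply: ideal_mul_in; do 2?eexists; split; try reflexivity;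
  do ?[apply: integersD|apply: integersM|apply: integersX|done].
Qed.

Lemma invertible_root_ideal : invertible_ideal (root_ideal 1).
Proof.
split; first exact: fractional_root_ideal.
exists (ideal_mul (root_ideal r.-1) (principal_ideal g^-1)).
  by apply: fractional_mul; [exact: fractional_root_ideal|exact: fractional_principal].
rewrite ideal_mulA root_idealS ?prednK // root_ideal_r principal_idealM divff //.
exact: principal_ideal1.
Qed.

Definition root_inv_ideal : inv_ideal K := InvIdeal (introT (asboolP _) invertible_root_ideal).

Lemma root_inv_idealX k : (k <= r)%N -> ideal_set (root_inv_ideal ^+ k)%g = root_ideal k.
Proof.
elim: k => [|k IH] kr; first by rewrite expg0 root_ideal0.
by rewrite expgS -root_idealS // -IH // ltnW.
Qed.

Lemma ideal_classX (I : inv_ideal K) k : (ideal_class I ^+ k)%g = ideal_class (I ^+ k)%g.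
Proof.
elim: k => [|k IH]; first by rewrite !expg0.
by rewrite !expgS IH [RHS]ideal_classM.
Qed.

Lemma ideal_class_eq1 (I : inv_ideal K) : ideal_class I = 1%g <-> is_principal I.
Proof.
have -> : (1 : class_group K)%g = ideal_class 1%g by [].
by rewrite ideal_classP invg1 mulg1.
Qed.

Lemma principalX (I : inv_ideal K) (a : K) k : ideal_set I = principal_ideal a ->
  ideal_set (I ^+ k)%g = principal_ideal (a ^+ k).
Proof.
move=> Ia; elim: k => [|k IH]; first by rewrite expg0 expr0 principal_ideal1.
by rewrite expgS exprS -principal_idealM -IH -Ia.
Qed.

(** If the order were smaller, the power [r %/ p] of the ideal would be principal for some prime [p]
    dividing [r], say generated by [a]. Then [g] and [a ^+ p] generate the same ideal and differ by
    a unit. *)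
Lemma root_class_order :
    (forall p, prime p -> (p %| r)%N ->
      ~ exists a u, integer_unit u /\ g = u * a ^+ p) ->
  has_order (ideal_class root_inv_ideal) r.
Proof.
move=> noroot; set c := ideal_class _.
have cr : (c ^+ r = 1)%g.
  rewrite /c ideal_classX; apply/ideal_class_eq1.
  by exists g => //; rewrite root_inv_idealX // root_ideal_r.
split=> // k /andP[k0 kr] ck.
(* By Bezout the class is killed by a proper divisor of [r], hence by [r %/ p] for a prime [p]. *)
have cg : (c ^+ gcdn k r = 1)%g.
  have [km kn E _] := egcdnP r k0.
  have := congr1 (fun i => (c ^+ i)%g) E; rewrite /= expgnDr.
  by rewrite (mulnC km) (mulnC kn) !expgnA ck cr !expg1n mul1g => <-.
set q := gcdn k r in cg; have q0 : (0 < q)%N by rewrite gcdn_gt0 k0.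
have rq : (1 < r %/ q)%N.
  rewrite -(ltn_pmul2r q0) divnK ?dvdn_gcdr // mul1n.
  by apply: leq_ltn_trans kr; apply: dvdn_leq (dvdn_gcdl _ _).
have pp := pdiv_prime rq; set p := pdiv _ in pp.
have prq : (p %| r %/ q)%N := pdiv_dvd _.
have pr : (p %| r)%N.
  by rewrite -(divnK (dvdn_gcdr k r)) -/q dvdn_mulr.
apply: (noroot p pp pr).
have crp : (c ^+ (r %/ p) = 1)%g.
  rewrite -(divnK (dvdn_gcdr k r)) -/q -(divnK prq) mulnAC mulnK ?prime_gt0 //.
  by rewrite mulnC expgnA cg expg1n.
have : is_principal (root_inv_ideal ^+ (r %/ p))%g.
  by apply/ideal_class_eq1; rewrite -ideal_classX.
case=> a a0 /(principalX p); rewrite -expgnA divnK // root_inv_idealX // root_ideal_r => E.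
have ap0 : a ^+ p != 0 by rewrite expf_neq0.
have [u Ou ug] : principal_ideal (a ^+ p) g.
  by rewrite -E; exists 1; rewrite ?mulr1 //; apply: integers1.
have [v Ov va] : principal_ideal g (a ^+ p).
  by rewrite E; exists 1; rewrite ?mulr1 //; apply: integers1.
have uv : u * v = 1.
  by apply: (mulfI ap0); rewrite mulr1 mulrA ug.
have u0 : u != 0 by apply: contra_eq_neq uv => ->; rewrite mul0r eq_sym oner_neq0.
exists a, u; split; last by rewrite mulrC.
split=> //; rewrite (_ : u^-1 = v) //.
by apply: (mulfI u0); rewrite uv divff.
Qed.

End RootIdeal.

(** Residues run from 1 to [p], not from 0: the exponents of [rho] and [eps] have to be positive in
    [small_conj_bounds]. *)
Lemma exists_residue (p : nat) (z : int) : (0 < p)%N ->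
  exists (m : nat) (l : int), (0 < m <= p)%N /\ m%:Z = z + p%:Z * l.
Proof.
move=> p0; exists (`|((z - 1) %% p)%Z|%N).+1, (- ((z - 1) %/ p)%Z).
have w0 : (0 <= (z - 1) %% p)%Z by apply: modz_ge0; rewrite -lt0n.
have wp : ((z - 1) %% p < p)%Z by apply: ltz_pmod.
have zE := divz_eq (z - 1) p.
move: ((z - 1) %% p)%Z ((z - 1) %/ p)%Z w0 wp zE => w q w0 wp zE; split; first by lia.
by rewrite -addn1 PoszD gez0_abs // -[z](subrK 1) zE; ring.
Qed.

(** * Powers up to sign, and estimates at the three real places *)

Section SignedPowers.
Variables (K : fieldType) (p : nat).
Implicit Types x y b : K.

Definition signed_power x := exists b, x = b ^+ p \/ x = - b ^+ p.

Lemma signed_powerM x y : signed_power x -> signed_power y -> signed_power (x * y).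
Proof.
move=> [b bE] [c cE]; exists (b * c); rewrite exprMn.
case: bE => ->; case: cE => ->; rewrite ?mulrN ?mulNr ?opprK; by [left|right].
Qed.

Lemma signed_powerV x : signed_power x -> signed_power x^-1.
Proof. by move=> [b [] ->]; exists b^-1; rewrite exprVn ?invrN; [left|right]. Qed.

Lemma signed_powerXz x (z : int) : signed_power x -> signed_power (x ^ z).
Proof.
move=> sx; have sX k : signed_power (x ^+ k).
  elim: k => [|k IH]; first by exists 1; left; rewrite expr0 expr1n.
  by rewrite exprS; apply: signed_powerM.
case: z => k; first exact: sX.
exact/signed_powerV/sX.
Qed.

Lemma signed_power_dvd x (z : int) : (p %| z)%Z -> signed_power (x ^ z).
Proof. by case/dvdzP=> q ->; exists (x ^ q); left; rewrite exprnP exprz_exp. Qed.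

End SignedPowers.

(** At the first place [r1] is small, at the second [r2 + 1] is. Each occurs with a positive
    exponent and yields the factor [1 / N], while the remaining factors contribute at most
    [8 ^+ p]. *)
Lemma small_conj_bounds (R : realFieldType) (N r1 r2 : R) (p i j k : nat) :
    16 <= N -> 0 < r1 <= N^-1 -> - 8 / N <= r2 + 1 < 0 ->
    (0 < i <= p)%N -> (0 < j <= p)%N -> (k <= p)%N ->
  `|r1| ^+ i * (`|r1 + 1| ^+ 3 / 2) ^+ j * `|r1 - 2| ^+ k <= 8 ^+ p / N /\
  `|r2| ^+ i * (`|r2 + 1| ^+ 3 / 2) ^+ j * `|r2 - 2| ^+ k <= 8 ^+ p / N.
Proof.
move=> N16 /andP[r1_0 r1_n] /andP[r2_n r2_0] /andP[i0 ip] /andP[j0 jp] kp.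
have N0 : 0 < N by lra.
have NV : N^-1 <= 1 / 16 by rewrite div1r lef_pV2 ?posrE.
have NV0 : 0 < N^-1 by rewrite invr_gt0.
have p0 : (0 < p)%N by apply: leq_trans i0 ip.
have expr_le (a c : R) (m : nat) : 0 <= a -> a <= c -> 1 <= c -> (m <= p)%N -> a ^+ m <= c ^+ p.
  move=> a0 ac c1 mp; apply: le_trans (_ : c ^+ m <= _); last by rewrite ler_weXn2l.
  by rewrite lerXn2r ?nnegrE; lra.
have expr_le1 (a c : R) (m : nat) : (0 < m)%N -> 0 <= a -> a <= c -> c <= 1 -> a ^+ m <= c.
  case: m => // m _ a0 ac c1; rewrite exprS -[leRHS]mulr1; apply: ler_pM => //.
    exact: exprn_ge0.
  by apply: exprn_ile1 => //; lra.
have pM (a1 a2 a3 c1 c2 c3 : R) : 0 <= a1 <= c1 -> 0 <= a2 <= c2 -> 0 <= a3 <= c3 ->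
    a1 * a2 * a3 <= c1 * c2 * c3.
  move=> /andP[? ?] /andP[? ?] /andP[? ?].
  by apply: ler_pM; rewrite ?mulr_ge0 //; apply: ler_pM.
split.
- rewrite (gtr0_norm r1_0) gtr0_norm; last by lra.
  rewrite ltr0_norm; last by lra.
  have -> : 8 ^+ p / N = N^-1 * 1 * 8 ^+ p by ring.
  have h0 : 0 <= (r1 + 1) ^+ 3 / 2 by rewrite divr_ge0 ?exprn_ge0 //; lra.
  apply: pM; rewrite exprn_ge0 /=; try lra.
  + by apply: expr_le1 => //; lra.
  + apply: exprn_ile1 => //; rewrite ler_pdivrMr // mul1r.
    apply: le_trans (_ : (5 / 4) ^+ 3 <= _); last by lra.
    by rewrite lerXn2r ?nnegrE; lra.
  + by apply: expr_le => //; lra.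
- have t2_ge : - (1 / 2) <= r2 + 1.
    by apply: le_trans r2_n; rewrite mulNr lerN2; lra.
  rewrite ltr0_norm; last by lra.
  rewrite (ltr0_norm r2_0) ltr0_norm; last by lra.
  have -> : 8 ^+ p / N = 2 ^+ p * N^-1 * 4 ^+ p.
    by rewrite (_ : 8 = 2 * 4 :> R) ?exprMn; [ring|rewrite -natrM].
  have h0 : 0 <= (- (r2 + 1)) ^+ 3 / 2 by rewrite divr_ge0 ?exprn_ge0 //; lra.
  apply: pM; rewrite exprn_ge0 /=; try lra.
  + by apply: expr_le => //; lra.
  + apply: expr_le1 => //; last by lra.
    apply: le_trans (_ : (8 / N) ^+ 3 / 2 <= _).
      rewrite ler_wpM2r ?invr_ge0 // lerXn2r ?nnegrE ?divr_ge0 ?(ltW N0) //; first by lra.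
      by rewrite lerNl -mulNr.
    (* This is 256 / N^3, which is at most 1 / N exactly because [16 <= N]. *)
    have -> : (8 / N) ^+ 3 / 2 = N^-1 * (256 * (N^-1 * N^-1)) by field; lra.
    rewrite -[leRHS]mulr1 ler_wpM2l // ?(ltW NV0) //.
    have : N^-1 * N^-1 <= 1 / 16 * (1 / 16) by apply: ler_pM => //; exact: ltW.
    lra.
  + by apply: expr_le => //; lra.
Qed.

(** These are the conjugates of [gam / rho]. Their mixed signs show that it is not an even power up
    to sign. *)
Lemma ratio_signs (R : realFieldType) (N r1 r2 r3 : R) :
    20 <= N -> 0 < r1 <= N^-1 -> - 8 / N <= r2 + 1 < 0 -> - N <= r3 <= - N + 2 ->
  [/\ 1 - 2 / r1 < 0, 0 < 1 - 2 / r2 & 0 < 1 - 2 / r3].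
Proof.
move=> N20 /andP[r1_0 r1_n] /andP[r2_n r2_0] /andP[r3_n r3_2].
split.
- rewrite subr_lt0 ltr_pdivlMr // mul1r; apply: le_lt_trans r1_n _.
  by rewrite invf_plt ?posrE; lra.
- by rewrite subr_gt0 ltr_ndivrMr; lra.
- by rewrite subr_gt0 ltr_ndivrMr; lra.
Qed.

(** The third factor is at most [4 / N], the second at most 2, and the first is below [N / 8], since
    [|b1| ^+ p = 2 / r1 - 1 < 4 * N] with [p >= 2]. *)
Lemma ratio_product_small (R : archiRcfType) (N r1 r2 r3 b1 b2 b3 : R) (p : nat) :
    400 <= N -> 0 < r1 <= N^-1 -> - 8 / N <= r2 + 1 < 0 -> - N <= r3 <= - N + 2 ->
    (1 < p)%N -> odd p ->
    r1 * r2 * r3 = 1 -> b1 ^+ p = 1 - 2 / r1 -> b2 ^+ p = 1 - 2 / r2 -> b3 ^+ p = 1 - 2 / r3 ->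
  `|b1 - 1| * `|b2 - 1| * `|b3 - 1| < 1.
Proof.
move=> N400 r1_bnd r2_bnd r3_bnd p1 podd e3 b1E b2E b3E.
have p0 : (0 < p)%N by apply: ltnW.
have N20 : 20 <= N by apply: le_trans N400; rewrite ler_nat.
have [h1 h2 h3] := ratio_signs N20 r1_bnd r2_bnd r3_bnd.
have NN : 400 * N <= N * N.
  by rewrite ler_wpM2r //; apply: le_trans N20.
clear N400; move: r1_bnd r2_bnd r3_bnd => /andP[r1_0 r1_n] /andP[r2_n r2_0] /andP[r3_n r3_2].
have N0 : 0 < N by apply: lt_le_trans N20.
have near1 (b h : R) : b ^+ p = 1 - h -> 0 < 1 - h -> `|b - 1| <= `|h|.
  move=> bE h0; have b0 : 0 <= b by rewrite -(exprn_odd_ge0 _ podd) bE ltW.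
  have := subX_geMl p0 b0 ler01.
  by rewrite !expr1n mulr1 bE addrAC subrr sub0r normrN.
have b3_le : `|b3 - 1| <= 4 / N.
  apply: le_trans (near1 _ _ b3E h3) _.
  clear -N20 N0 r3_n r3_2.
  rewrite normrM normfV normr_nat ler0_norm; last by lra.
  rewrite ler_pdivrMr; last by lra.
  by rewrite mulrAC ler_pdivlMr //; lra.
have b2_le : `|b2 - 1| <= 2.
  apply: le_trans (near1 _ _ b2E h2) _.
  clear -r2_0.
  rewrite normrM normfV normr_nat ler0_norm; last by lra.
  by rewrite ler_pdivrMr; lra.
have b1_lt : `|b1 - 1| < N / 8.
  apply: le_lt_trans (ler_normB _ _) _; rewrite normr1 -ltrBrDr ltNge.
  apply/negP => big.
  have bp : `|b1| ^+ p = 2 / r1 - 1 by rewrite -normrX b1E (ltr0_norm h1) opprB.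
  have r1V : r1^-1 <= 2 * N.
    have r23 : 0 < r2 * r3 by clear -r2_0 r3_2 N20; rewrite nmulr_rgt0; lra.
    have -> : r1^-1 = - r2 * - r3.
      by rewrite mulrNN; apply: (mulfI (lt0r_neq0 r1_0)); rewrite mulrA e3 mulfV // gt_eqF.
    have NV : N^-1 <= 1 / 20 by rewrite div1r lef_pV2 ?posrE.
    clear -NV r2_n r2_0 r3_n r3_2 N20.
    by apply: ler_pM; lra.
  have : (N / 9) ^+ 2 <= `|b1| ^+ p.
    clear -N20 NN big p1 N0.
    have N9 : N / 9 <= `|b1|.
      apply: le_trans big; have : 72 <= N; last by lra.
      by rewrite -(ler_pM2r N0); apply: le_trans NN; rewrite ler_pM2r // ler_nat.
    apply: le_trans (_ : `|b1| ^+ 2 <= _); first by rewrite lerXn2r ?nnegrE; lra.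
    by rewrite ler_weXn2l //; lra.
  by rewrite bp; clear -r1V NN N0; lra.
apply: le_lt_trans (_ : `|b1 - 1| * 2 * (4 / N) < 1).
  by apply: ler_pM; rewrite ?mulr_ge0 ?ler_wpM2l.
by rewrite mulrA ltr_pdivrMr // mul1r; clear -b1_lt; lra.
Qed.

(** * The units rho and eps, the element rho - 2 and its relations *)

Section Family.
Variables (R : archiRcfType) (K : fieldExtType rat) (n : int) (rho : K).
Hypotheses (n1000 : 1000 <= n) (n_odd : ~~ (2 %| n)%Z).
Hypothesis rho0 : root (map_poly intr (f_poly n)) rho.
Hypothesis K_gen : <<1; rho>>%VS = fullv.
Variables (s1 s2 s3 : {rmorphism K -> R}).
Let r1 := s1 rho. Let r2 := s2 rho. Let r3 := s3 rho.
Hypotheses (e1 : r1 + r2 + r3 = - n%:~R)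
  (e2 : r1 * r2 + r1 * r3 + r2 * r3 = n%:~R) (e3 : r1 * r2 * r3 = 1).
Hypotheses (r1_bnd : 0 < r1 <= n%:~R^-1) (r2_bnd : - 8 / n%:~R <= r2 + 1 < 0)
  (r3_bnd : - n%:~R <= r3 <= - n%:~R + 2).

Let n0 : n != 0. Proof. by apply: contraTneq n1000 => ->. Qed.
Let kR : 1000 <= n%:~R :> R. Proof. by rewrite (ler_int R 1000). Qed.

Lemma rho_cubic : rho ^+ 3 + n%:~R * rho ^+ 2 + n%:~R * rho - 1 = 0.
Proof. by rewrite -horner_f; apply/rootP. Qed.

Lemma integers_rho : ring_of_integers rho.
Proof. by exists (f_poly n); rewrite ?f_monic. Qed.

Lemma unit_rho : integer_unit rho.
Proof.
have rho_neq0 : rho != 0.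
  by apply: contra_eq_neq e3 => rho_eq0; rewrite /r1 rho_eq0 rmorph0 !mul0r eq_sym oner_neq0.
split=> //; first exact: integers_rho.
by apply: (integersV rho0 K_gen e1 e2 integers_rho); rewrite -/r1 -/r2 -/r3 e3 normr1.
Qed.

(* A unit, since 2 is totally ramified: (2) = (rho + 1)^3. *)
Definition eps : K := (rho + 1) ^+ 3 / 2.

Lemma two_neq0 : 2 != 0 :> K.
Proof. by rewrite -(fmorph_eq0 s1) rmorph_nat pnatr_eq0. Qed.

Lemma unit_eps : integer_unit eps.
Proof.
have [m nE] : exists m : int, n = 2 * m + 3.
  by exists ((n - 3) %/ 2)%Z; clear -n_odd; lia.
(* Expanding f_n at [t = rho + 1] gives [t ^+ 3 = 2 + (n - 3) * (t - t ^+ 2)], where [n - 3 = 2 * m]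
   because [n] is odd. *)
have epsE : eps = 1 + m%:~R * ((rho + 1) - (rho + 1) ^+ 2).
  rewrite /eps; apply: (canLR (mulfK two_neq0)); apply/eqP; rewrite -subr_eq0.
  rewrite -[X in _ == X]rho_cubic nE rmorphD rmorphM /=; apply/eqP; ring.
have O_rho1 : ring_of_integers (rho + 1) by apply: integersD; [exact: integers_rho|exact: integers1].
have Oeps : ring_of_integers eps.
  rewrite epsE; apply: integersD; first exact: integers1.
  by apply: integersM; [exact: integers_int|apply: integersB => //; exact: integersX].
split=> //; last first.
  apply: (integersV rho0 K_gen e1 e2 Oeps).
  (* The norm of [rho + 1] is -f_n(-1) = 2, so [eps] has norm 1. *)
  have -> : s1 eps * s2 eps * s3 eps =
      ((1 + (r1 + r2 + r3) + (r1 * r2 + r1 * r3 + r2 * r3) + r1 * r2 * r3) / 2) ^+ 3.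
    rewrite /eps !(rmorphM, fmorphV, rmorphD, rmorphXn, rmorph1) /= -/r1 -/r2 -/r3; ring.
  rewrite e1 e2 e3 subrK -[1 + 1]/(2%:R) divff ?expr1n ?normr1 //.
  by rewrite pnatr_eq0.
rewrite /eps mulf_neq0 ?invr_eq0 ?two_neq0 // expf_neq0 // -(fmorph_eq0 s2).
by rewrite rmorphD rmorph1 -/r2 lt_eqF //; case/andP: r2_bnd.
Qed.

Definition gam : K := rho - 2.

Lemma integers_gam : ring_of_integers gam.
Proof. by apply: integersB; [exact: integers_rho|exact: (integers_int K 2)]. Qed.

Lemma gam_neq0 : gam != 0.
Proof.
rewrite -(fmorph_eq0 s2) rmorphB rmorph_nat -/r2 lt_eqF //.
case/andP: r2_bnd; lra.
Qed.

(** Minus the quotient of f_n(X) - f_n(2) by X - 2, evaluated at [rho]. *)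
Definition gam_cofactor : K := - (rho ^+ 2 + (n + 2)%:~R * rho + (3 * n + 4)%:~R).

Lemma integers_cofactor : ring_of_integers gam_cofactor.
Proof.
apply: integersN; apply: integersD; last exact: integers_int.
apply: integersD; first by apply: integersX; exact: integers_rho.
by apply: integersM; [exact: integers_int|exact: integers_rho].
Qed.

Lemma gam_mul_cofactor : gam * gam_cofactor = (6 * n + 7)%:~R.
Proof.
apply/eqP; rewrite -subr_eq0 -oppr_eq0 -[X in _ == X]rho_cubic /gam /gam_cofactor.
by apply/eqP; rewrite !rmorphD !rmorphM /=; ring.
Qed.

(* 6 (5 n + 12) - 5 (6 n + 7) = 37, where 5 n + 12 = f'(2). *)
Lemma coprime_cofactor : coprimez 37 (6 * n + 7) ->
  exists A B : K, [/\ ring_of_integers A, ring_of_integers B & A * gam_cofactor + B * gam = 1].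
Proof.
move=> /coprimezP[[s t] /= st].
have Orho := integers_rho; have OI := integers_int K.
exists (- (6 * s)%:~R), (- (6 * s)%:~R * (rho + (n + 4)%:~R) + (t - 5 * s)%:~R * gam_cofactor).
split.
- exact/integersN/OI.
- apply: integersD; apply: integersM => //; last exact: integers_cofactor.
    exact/integersN/OI.
  exact: integersD.
have -> : - (6 * s)%:~R * gam_cofactor + (- (6 * s)%:~R * (rho + (n + 4)%:~R)
      + (t - 5 * s)%:~R * gam_cofactor) * gam
    = (6 * s)%:~R * (- gam_cofactor - gam * (rho + (n + 4)%:~R))
      + (t - 5 * s)%:~R * (gam * gam_cofactor).
  by move: gam gam_cofactor (_%:~R) (_%:~R) (_%:~R) => u v a b c; ring.
rewrite gam_mul_cofactor (_ : - gam_cofactor - _ = (5 * n + 12)%:~R).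
  transitivity ((s * 37 + t * (6 * n + 7))%:~R : K); last by rewrite st.
  by rewrite !(rmorphB, rmorphD, rmorphM) /=; ring.
by rewrite /gam_cofactor /gam !rmorphD !rmorphM /=; ring.
Qed.

Lemma norm_conj_power (s : {rmorphism K -> R}) (p i j k : nat) (b : K) :
    rho ^+ i * eps ^+ j * gam ^+ k = b ^+ p \/ rho ^+ i * eps ^+ j * gam ^+ k = - b ^+ p ->
  `|s b| ^+ p = `|s rho| ^+ i * (`|s rho + 1| ^+ 3 / 2) ^+ j * `|s rho - 2| ^+ k.
Proof.
have epsE : `|s eps| = `|s rho + 1| ^+ 3 / 2.
  by rewrite /eps rmorphM fmorphV rmorphXn rmorphD rmorph1 normrM normfV normrX rmorph_nat normr_nat.
have gamE : `|s gam| = `|s rho - 2| by rewrite /gam rmorphB rmorph_nat.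
rewrite -epsE -gamE -!normrX -!normrM -!rmorphXn -!rmorphM.
by case=> ->; rewrite ?rmorphN ?normrN.
Qed.

Lemma small_conj (p i j k : nat) (b : K) : (0 < i <= p)%N -> (0 < j <= p)%N -> (k <= p)%N ->
    rho ^+ i * eps ^+ j * gam ^+ k = b ^+ p \/ rho ^+ i * eps ^+ j * gam ^+ k = - b ^+ p ->
  `|s1 b| ^+ p <= 8 ^+ p / n%:~R /\ `|s2 b| ^+ p <= 8 ^+ p / n%:~R.
Proof.
move=> ip jp kp bE; rewrite !(norm_conj_power _ bE).
by apply: small_conj_bounds => //; apply: le_trans kR; rewrite ler_nat.
Qed.

(** For even [p] the signs at the first and third places conflict. For odd [p] the sign goes into
    [b], which is integral; then [b - 1] is a nonzero integer of norm less than 1 in absolute value,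
    which is impossible. *)
Lemma ratio_not_power (p : nat) (b : K) : (1 < p)%N ->
  ~ (gam / rho = b ^+ p \/ gam / rho = - b ^+ p).
Proof.
move=> p1 bE; have p0 : (0 < p)%N by apply: ltnW.
have [/andP[r1_0 r1_n] /andP[r2_n r2_0] /andP[r3_n r3_2]] := And3 r1_bnd r2_bnd r3_bnd.
have [rho_neq0 Orho OVrho] := unit_rho.
have N400 : 400 <= n%:~R :> R by rewrite (ler_int R 400); apply: le_trans n1000.
have sE (s : {rmorphism K -> R}) : s (gam / rho) = 1 - 2 / s rho.
  by rewrite /gam rmorphM fmorphV rmorphB rmorph_nat /= mulrBl divff ?fmorph_eq0.
have N20 : 20 <= n%:~R :> R by apply: le_trans N400; rewrite ler_nat.
have [h1 h2 h3] := ratio_signs N20 r1_bnd r2_bnd r3_bnd.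
have [podd|peven] := boolP (odd p); last first.
  have pow_ge0 (s : {rmorphism K -> R}) : 0 <= s (b ^+ p).
    by rewrite rmorphXn exprn_even_ge0.
  rewrite -(sE s1) -(sE s3) in h1 h3.
  by case: bE => bE; [move: h1|move: h3]; rewrite bE ?rmorphN ?oppr_gt0 ltNge pow_ge0.
wlog bE' : b bE / gam / rho = b ^+ p.
  move=> wl; case: (bE) => bE'; first exact: (wl b).
  have bE2 : gam / rho = (- b) ^+ p by rewrite exprNn -signr_odd podd expr1 mulN1r.
  by apply: (wl (- b)) => //; left.
have Ob : ring_of_integers b.
  apply: (integers_root_exp p0); rewrite -bE'.
  by apply: integersM => //; apply: integers_gam.
have Ob1 : ring_of_integers (b - 1) by apply: integersB => //; apply: integers1.
have [_ [_ [M [_ _ ME]]]] := charpoly_int rho0 K_gen e1 e2 Ob1.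
have b1 : b - 1 != 0.
  rewrite subr_eq0; apply/eqP => b1; move: bE' => /(congr1 s1); rewrite b1 expr1n rmorph1.
  by rewrite sE => h; move: h1; rewrite h ltNge ler01.
have M1 : 1 <= `|s1 (b - 1)| * `|s2 (b - 1)| * `|s3 (b - 1)|.
  rewrite -!normrM ME -intr_norm (ler_int R 1) -gtz0_ge1 normr_gt0.
  by rewrite -(intr_eq0 R) -ME !mulf_neq0 // fmorph_eq0.
have pE (s : {rmorphism K -> R}) : s b ^+ p = 1 - 2 / s rho.
  by rewrite -sE bE' rmorphXn.
have := ratio_product_small N400 r1_bnd r2_bnd r3_bnd p1 podd e3 (pE s1) (pE s2) (pE s3).
by rewrite !rmorphB !rmorph1 in M1 *; rewrite ltNge M1.
Qed.

(** Here [x * v = - (6 * r3)^-1], so [1 - 6 * (x * v)] is [(r3 + 1) / r3] and [1 + 12 * (x * v)] is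
    [(r3 - 2) / r3]. The two equations are f_n(r3) = 0 and [norm_conj_power] in these variables. *)
Lemma place3_equations (p i j k : nat) (b : K) :
    rho ^+ i * eps ^+ j * gam ^+ k = b ^+ p \/ rho ^+ i * eps ^+ j * gam ^+ k = - b ^+ p ->
  let x := (6 * n%:~R + 7)^-1 : R in let v := - (6 * x * r3)^-1 in
  let M := (i + 3 * j + k)%N in
  [/\ 1 / 2 <= v <= 2,
      v = 1 + x * (7 * v + 6 * v ^+ 2) - 42 * (x ^+ 2 * v ^+ 2) + 216 * (x ^+ 3 * v ^+ 3)
    & `|s3 b| ^+ p * v ^+ M * x ^+ M * (2 ^ j * 6 ^ M)%:R
      = (1 - 6 * (x * v)) ^+ (3 * j) * (1 + 12 * (x * v)) ^+ k].
Proof.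
move=> bE x v M; have /andP[r3_n r3_2] := r3_bnd.
have F3 : r3 ^+ 3 + n%:~R * r3 ^+ 2 + n%:~R * r3 - 1 = 0.
  by have := congr1 s3 rho_cubic;
    rewrite !(rmorphB, rmorphD, rmorphM, rmorphXn, rmorph1, rmorph0, rmorph_int).
move: kR F3 r3_n r3_2; rewrite /v /x {v x}; set N : R := n%:~R => N1000 F3 r3_n r3_2.
set D := 6 * N + 7; have D0 : 0 < D by rewrite /D; lra.
have r30 : r3 < 0 by lra.
have r3N0 : r3 != 0 by rewrite lt_eqF.
have vE : - (6 * D^-1 * r3)^-1 = D / (6 * - r3).
  by field; rewrite r3N0 gt_eqF.
have xvE : D^-1 * (D / (6 * - r3)) = - (6 * r3)^-1 by field; rewrite r3N0 gt_eqF.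
rewrite vE; split.
- rewrite ler_pdivlMr ?ler_pdivrMr /D; try lra.
- apply/eqP; rewrite -subr_eq0.
  have -> : D / (6 * - r3) - (1 + D^-1 * (7 * (D / (6 * - r3)) + 6 * (D / (6 * - r3)) ^+ 2) -
      42 * (D^-1 ^+ 2 * (D / (6 * - r3)) ^+ 2) + 216 * (D^-1 ^+ 3 * (D / (6 * - r3)) ^+ 3))
     = - (r3 ^+ 3 + N * r3 ^+ 2 + N * r3 - 1) / r3 ^+ 3.
    rewrite /D; field; rewrite r3N0 -/D gt_eqF //.
  by rewrite F3 oppr0 mul0r.
rewrite (norm_conj_power _ bE) -/r3 xvE.
rewrite (ltr0_norm r30) ltr0_norm; last by lra.
rewrite ltr0_norm; last by lra.
have -> : 1 - 6 * - (6 * r3)^-1 = - (r3 + 1) / - r3 by field.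
have -> : 1 + 12 * - (6 * r3)^-1 = - (r3 - 2) / - r3 by field.
rewrite natrM !natrX.
have -> : (- r3) ^+ i * ((- (r3 + 1)) ^+ 3 / 2) ^+ j * (- (r3 - 2)) ^+ k
   * (D / (6 * - r3)) ^+ M * D^-1 ^+ M * (2 ^+ j * 6 ^+ M)
  = (- r3) ^+ i * ((- (r3 + 1)) ^+ 3 / 2 * 2) ^+ j * (- (r3 - 2)) ^+ k
     * (D / (6 * - r3) * D^-1 * 6) ^+ M by rewrite !exprMn; ring.
have -> : D / (6 * - r3) * D^-1 * 6 = (- r3)^-1 by field; rewrite r3N0 gt_eqF.
rewrite divfK ?pnatr_eq0 // -[((- (r3 + 1)) ^+ 3) ^+ j]exprM /M
  (exprD _ (i + 3 * j)) (exprD _ i (3 * j)).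
have u1 : (- r3) ^+ i * (- r3)^-1 ^+ i = 1.
  by rewrite -exprMn divff ?expr1n // oppr_eq0.
rewrite [(- (r3 + 1) / - r3) ^+ _]exprMn [(- (r3 - 2) / - r3) ^+ _]exprMn.
set u := (- r3)^-1 in u1 *.
transitivity ((- r3) ^+ i * u ^+ i * ((- (r3 + 1)) ^+ (3 * j) * u ^+ (3 * j))
  * ((- (r3 - 2)) ^+ k * u ^+ k)).
  by move: (_ ^+ i) (_ ^+ (3 * j)) (_ ^+ k) (u ^+ i) (u ^+ (3 * j)) (u ^+ k) => *; ring.
by rewrite u1 mul1r.
Qed.

Variables (r y : nat).
Hypotheses (r_gt0 : (0 < r)%N) (yr : 6 * n + 7 = (y ^ r)%N) (y37 : coprime 37 y).

(** Modulo [p]-th powers [u] equals [gam], so a relation among [rho], [eps], [u] is one for [gam] as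
    well. If [p] divided both [j] and [i + k], then [gam / rho] would be a [p]-th power up to sign,
    against [ratio_not_power]; otherwise the exponents are reduced modulo [p]. *)
Lemma power_relation (p : nat) (a u : K) : prime p -> integer_unit u -> gam = u * a ^+ p ->
  exists i j k : nat, [/\ (0 < i <= p)%N, (0 < j <= p)%N, (k <= p)%N,
    ~~ ((p %| j) && (p %| i + 3 * j + k))%N & signed_power p (rho ^+ i * eps ^+ j * gam ^+ k)].
Proof.
move=> pp uU gE; have p0 := prime_gt0 pp.
have rhoU := unit_rho.
have epsU := unit_eps.
have [rho_neq0 _ _] := rhoU; have [eps_neq0 _ _] := epsU; have [u0 _ _] := uU.
have gam0 : gam != 0 by exact: gam_neq0.
have [i [j [k [nd rel]]]] := dirichlet_mod n0 rho0 K_gen e1 e2 pp rhoU epsU uU.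
have spd x z := @signed_power_dvd K p x z.
have rel_gam : signed_power p (rho ^ i * eps ^ j * gam ^ k).
  have -> : rho ^ i * eps ^ j * gam ^ k = (rho ^ i * eps ^ j * u ^ k) * (gam / u) ^ k.
    have -> : (gam / u) ^ k = gam ^ k * (u ^ k)^-1 by rewrite expfzMl exprz_inv invr_expz.
    by field; rewrite expfz_neq0.
  apply: signed_powerM; first by exists 1; rewrite expr1n.
  apply: signed_powerXz; exists a; left; rewrite gE mulrAC divff ?mul1r //.
have [/andP[pj pik]|good] := boolP ((p %| j)%Z && (p %| i + k)%Z).
  exfalso.
  (* If [p] divided [k], it would divide all three exponents. *)
  have pk : coprimez k p.
    rewrite coprimezE coprime_sym prime_coprime //.
    apply: contra nd => pk; have {}pk : (p %| k)%Z by [].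
    have pi : (p %| i)%Z by rewrite -[i](addrK k) rpredB.
    by rewrite pi pj pk.
  have [[s t] /= st] := coprimezP _ _ pk.
  have sp_ratio : signed_power p ((gam / rho) ^ k).
    have -> : (gam / rho) ^ k = rho ^ i * eps ^ j * gam ^ k * rho ^ (- (i + k)) * eps ^ (- j).
      have -> : (gam / rho) ^ k = gam ^ k * (rho ^ k)^-1 by rewrite expfzMl exprz_inv invr_expz.
      rewrite opprD expfzDr // -!invr_expz.
      by field; rewrite ?expfz_neq0.
    apply: signed_powerM; first apply: signed_powerM => //.
      by apply: spd; rewrite dvdzN || rewrite rpredN.
    by apply: spd; rewrite rpredN.
  have : signed_power p (gam / rho).
    have -> : gam / rho = ((gam / rho) ^ k) ^ s * (gam / rho) ^ (t * p).
      by rewrite exprz_exp [k * s]mulrC -expfzDr ?st ?expr1z // mulf_neq0 ?invr_eq0.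
    apply: signed_powerM; first exact: signed_powerXz.
    by apply: spd; apply: dvdz_mull.
  case=> b; apply: (ratio_not_power).
  exact: prime_gt1.
have [i' [l1 [i'P i'E]]] := exists_residue i p0.
have [j' [l2 [j'P j'E]]] := exists_residue j p0.
have [k' [l3 [/andP[_ k'P] k'E]]] := exists_residue k p0.
exists i', j', k'; split=> //.
  apply: contra good => /andP[pj' pijk].
  have pjz : (p %| j)%Z.
    have : (p %| j'%:Z)%Z by [].
    by rewrite j'E rpredDr // dvdz_mulr.
  rewrite pjz /=; have : (p %| (i' + 3 * j' + k')%N%:Z)%Z by [].
  have -> : (i' + 3 * j' + k')%N%:Z = i'%:Z + 3 * j'%:Z + k'%:Z by clear; lia.
  rewrite i'E j'E k'E.
  have -> : i + p%:Z * l1 + 3 * (j + p%:Z * l2) + (k + p%:Z * l3)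
     = (i + k) + (3 * j + p%:Z * (l1 + 3 * l2 + l3)) by ring.
  set w := 3 * j + _ => pw; rewrite -[i + k](addrK w) rpredB //.
  by apply: rpredD; [exact: dvdz_mull|exact: dvdz_mulr].
have -> : rho ^+ i' * eps ^+ j' * gam ^+ k'
   = rho ^ i * eps ^ j * gam ^ k * (rho ^ (p%:Z * l1) * eps ^ (p%:Z * l2) * gam ^ (p%:Z * l3)).
  by rewrite !exprnP i'E j'E k'E !expfzDr //; ring.
apply: signed_powerM => //; do 2?[apply: signed_powerM]; apply: spd; exact: dvdz_mulr.
Qed.

Lemma class_or_relation : (exists c : class_group K, has_order c r) \/
  exists p i j k : nat, [/\ prime p, (p %| r)%N &
    [/\ (0 < i <= p)%N, (0 < j <= p)%N, (k <= p)%N,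
    ~~ ((p %| j) && (p %| i + 3 * j + k))%N & signed_power p (rho ^+ i * eps ^+ j * gam ^+ k)]].
Proof.
apply: contrapT => /not_orP[nc nrel]; apply: nc.
have cop : coprimez 37 (6 * n + 7) by rewrite yr coprimezE coprimeXr.
have [A [B [OA OB AB]]] := coprime_cofactor cop.
have gc : gam * gam_cofactor = (y%:R : K) ^+ r.
  by rewrite gam_mul_cofactor yr -pmulrn natrX.
have gam0 : gam != 0 by exact: gam_neq0.
have Oy : ring_of_integers (y%:R : K) by exact: (integers_int K y).
exists (ideal_class (root_inv_ideal r_gt0 gam0 Oy integers_gam integers_cofactor OA OB gc AB)).
apply: root_class_order => p pp pr [a [u [uU gE]]]; apply: nrel.
have [i [j [k relP]]] := power_relation pp uU gE.
by exists p, i, j, k.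
Qed.

End Family.

(** * Choice of the parameter *)

(** The field and its generator are quantified away, which leaves a condition on [y] alone, as
    [exists_far] needs. *)
Definition relation_at (r p i j k y : nat) : Prop :=
  exists (n : int) (K : fieldExtType rat) (rho : K),
    [/\ 1000 <= n, ~~ (2 %| n)%Z, 6 * n + 7 = (y ^ r)%N,
      root (map_poly intr (f_poly n)) rho /\ <<1; rho>>%VS = fullv
      & signed_power p (rho ^+ i * eps rho ^+ j * gam rho ^+ k)].

Section NearIntegers.
Variable R : archiRcfType.

(** As [p <= r], [y ^ p] is at most [6 * N + 7 <= 7 * N], so the [p]-th root of [c / N] is
    [O(1 / y)]. *)
Lemma root_le_div (p r y : nat) (N c a : R) : (0 < p <= r)%N -> 7 <= N -> 6 * N + 7 = y%:R ^+ r ->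
  1 <= c -> 0 <= a -> a ^+ p <= c / N -> a <= 7 * c / y%:R.
Proof.
move=> /andP[p0 pr] N7 yr c1 a0 aN.
have N0 : 0 < N by lra.
have y1 : 1 <= y%:R :> R.
  rewrite ler1n lt0n; apply/eqP => y0; move: yr; rewrite y0 expr0n.
  by rewrite (gtn_eqF (leq_trans p0 pr)) /=; lra.
have y0 : 0 < y%:R :> R by lra.
have c0 : 0 <= 7 * c by lra.
rewrite -(ler_pXn2r p0) ?nnegrE ?divr_ge0 ?(ltW y0) //.
apply: le_trans aN _; rewrite expr_div_n ler_pdivlMr ?exprn_gt0 //.
have yp : y%:R ^+ p <= 7 * N.
  apply: le_trans (_ : y%:R ^+ r <= _); first by rewrite ler_weXn2l.
  by rewrite -yr; lra.
apply: le_trans (_ : 7 * c <= _).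
  rewrite mulrAC ler_pdivrMr // [7 * c]mulrC -mulrA ler_wpM2l //; lra.
case: (p) p0 => // q _; rewrite exprS -[leLHS]mulr1 ler_wpM2l // exprn_ege1 //; lra.
Qed.

Lemma relation_near (r p i j k : nat) : (0 < r)%N -> prime p -> (p %| r)%N ->
    (0 < i <= p)%N -> (0 < j <= p)%N -> (k <= p)%N ->
    ~~ ((p %| j) && (p %| i + 3 * j + k))%N ->
  exists (P : {poly R}) (C : R), [/\ (1 < size P)%N, irrational (lead_coef P)
    & forall y, C <= y%:R -> relation_at r p i j k y -> near_int (C / y%:R) P.[y%:R]].
Proof.
move=> r0 pp pr ip jp kp nd; have p0 := prime_gt0 pp.
set M := (i + 3 * j + k)%N in nd.
have M0 : (0 < M)%N by case/andP: ip => i0 _; rewrite /M -addnA addn_gt0 i0.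
have rE : (p * (r %/ p))%N = r by rewrite mulnC divnK.
have s0 : (0 < r %/ p)%N by rewrite divn_gt0 // dvdn_leq.
have [P [C [sP [lP0 lPE] PC]]] := @near_expansion R p (r %/ p) j k M p0 s0 M0.
pose c' : R := 7 * 8 ^+ p.
have c'0 : 0 <= c' by rewrite mulr_ge0 ?exprn_ge0.
exists P, (C + (c' + c')); split=> //.
  exact: irrational_root lPE nd.
move=> y Cy [n [K [rho [n1000 n_odd yr [rho0 K_gen] [b bE]]]]].
have Cy' : C <= y%:R by apply: le_trans Cy; rewrite lerDl addr_ge0.
have n0 : n != 0 by apply: contraTneq n1000 => ->.
have n100 : 100 <= n by apply: le_trans n1000.
have [s1 [s2 [s3 [[e1 e2 e3] [r1_bnd r2_bnd r3_bnd]]]]] := exists_conjugates R n100 rho0 K_gen.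
have kR : 1000 <= n%:~R :> R by rewrite (ler_int R 1000).
have yrR : 6 * n%:~R + 7 = y%:R ^+ r :> R.
  by rewrite -natrX -[(y ^ r)%:R]/((y ^ r)%N%:~R) -yr rmorphD rmorphM.
have Ob : ring_of_integers b.
  apply: (integers_root_exp p0).
  have Oprod : ring_of_integers (rho ^+ i * eps rho ^+ j * gam rho ^+ k).
    do 2?[apply: integersM]; apply: integersX.
    - exact: integers_rho rho0.
    - by case: (unit_eps n_odd rho0 K_gen e1 e2 e3 r2_bnd).
    - exact: integers_gam rho0.
  by case: bE Oprod => -> // /integersN; rewrite opprK.
have [T [_ [_ [TE _ _]]]] := charpoly_int rho0 K_gen e1 e2 Ob.
have [sm1 sm2] := small_conj n1000 r1_bnd r2_bnd ip jp kp bE.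
have pr_le : (0 < p <= r)%N by rewrite p0 dvdn_leq.
have n7 : 7 <= n%:~R :> R by apply: le_trans kR; rewrite ler_nat.
have c8 : 1 <= 8 ^+ p :> R by rewrite exprn_ege1 // ler1n.
have le_c (t : R) : 0 <= t -> t ^+ p <= 8 ^+ p / n%:~R -> t <= c' / y%:R.
  exact: root_le_div yrR c8.
have b1 : `|s1 b| <= c' / y%:R.
  by apply: le_c => //; rewrite (norm_conj_power _ bE).
have b2 : `|s2 b| <= c' / y%:R.
  by apply: le_c => //; rewrite (norm_conj_power _ bE).
have [] := place3_equations n1000 rho0 r3_bnd bE.
rewrite yrR -rE => vP vE BE; have b3 := PC y _ _ Cy' vP (normr_ge0 _) vE BE.
(* The expansion is that of [|s3 b|], so the trace is taken with the sign of [s3 b]. *)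
exists (if 0 <= s3 b then T else - T).
have -> : P.[y%:R] - (if 0 <= s3 b then T else - T)%:~R
    = - (`|s3 b| - P.[y%:R]) - (-1) ^+ (s3 b < 0)%R * (s1 b + s2 b).
  have [s3b|s3b] := lerP 0 (s3 b).
    by rewrite (ger0_norm s3b) expr0 -TE; ring.
  by rewrite (ltr0_norm s3b) expr1 rmorphN /= -TE; ring.
apply: le_trans (ler_normB _ _) _; rewrite normrN mulrDl; apply: lerD => //.
rewrite normrM normr_sign mul1r; apply: le_trans (ler_normD _ _) _.
by rewrite mulrDl; apply: lerD.
Qed.

(** A rational square root of [disc m] would be an integer, but [disc m] lies strictly between the
    squares of [m ^+ 2 - 10] and [m ^+ 2 - 9]. *)
Lemma disc_not_square (m : int) : 1000 <= m -> forall q z : int, 0 < q -> q ^+ 2 * disc m != z ^+ 2.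
Proof.
move=> m1000 q z q0; apply/eqP => E.
have [|w wE] := @integral_rat_int (z%:~R / q%:~R).
  exists ('X^2 - (disc m)%:P).
    by rewrite monicE lead_coefDl ?lead_coefXn // size_polyXn size_polyN ltnS
      (leq_trans (size_polyC_leq1 _)).
  rewrite /root rmorphB /= map_polyXn map_polyC !(hornerD, hornerN, hornerXn, hornerC).
  rewrite expr_div_n -rmorphXn -E rmorphM rmorphXn /= mulrAC divff ?mul1r ?subrr //.
  by rewrite expf_neq0 // intr_eq0 gt_eqF.
have zE : z = w * q.
  apply: (@intr_inj rat); rewrite rmorphM /= -wE divfK //.
  by rewrite intr_eq0 gt_eqF.
have wD : w ^+ 2 = disc m.
  apply: (mulfI (x := q ^+ 2)); first by rewrite expf_neq0 // gt_eqF.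
  by rewrite E zE; ring.
have {}wD : `|w| ^+ 2 = (m ^+ 2 - 9) ^+ 2 - 108 by rewrite -normrX wD ger0_norm // -wD sqr_ge0.
have m2 : 1000 * 1000 <= m ^+ 2 by rewrite expr2; apply: ler_pM.
move: (m ^+ 2) m2 wD => M M2 wD; have w0 := normr_ge0 w; move: (`|w|) w0 wD => u u0 uD.
have u1 : u < M - 9.
  by rewrite -(ltr_pXn2r (n := 2)) ?nnegrE //; [rewrite uD; lia|lia].
have u2 : M - 10 < u.
  rewrite -(ltr_pXn2r (n := 2)) ?nnegrE //; [rewrite uD|lia].
  have -> : (M - 10) ^+ 2 = (M - 9) ^+ 2 - 2 * M + 19 by ring.
  lia.
lia.
Qed.

(** With [a] the square root of [disc m], [P] takes the value [A = a * (n ^+ 2 - 9)] at [y]. For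
    [Z = |z|] one has [(A - Z) * (A + Z) = 108 * a ^+ 2], and since [A + Z >= a * n] and
    [y <= 7 * n], [A - Z] is [O(1 / y)]. *)
Lemma disc_near (r : nat) (m : int) : (0 < r)%N -> 1000 <= m ->
  exists (P : {poly R}) (C : R), [/\ (1 < size P)%N, irrational (lead_coef P)
    & forall (y : nat) (n z : int), C <= y%:R -> 1000 <= n -> 6 * n + 7 = (y ^ r)%N ->
        z ^+ 2 = disc m * disc n -> near_int (C / y%:R) P.[y%:R]].
Proof.
move=> r0 m1000.
have D0 : 0 < disc m by rewrite /disc expr2 subr_gt0; nia.
have [a a0 aE] : exists2 a : R, 0 < a & a ^+ 2 = (disc m)%:~R.
  by apply: exists_root => //; rewrite ltr0z.
pose Q : {poly R} := 'X^r - 7%:P.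
pose P : {poly R} := (a / 36) *: (Q ^+ 2 - (36 * 9)%:P).
have sQ : size Q = r.+1.
  by rewrite size_polyDl ?size_polyXn // size_polyN ltnS (leq_trans (size_polyC_leq1 _)).
have lQ : Q \is monic.
  by rewrite monicE lead_coefDl ?lead_coefXn // size_polyXn size_polyN ltnS
    (leq_trans (size_polyC_leq1 _)).
have sQ2 : size (Q ^+ 2) = (2 * r).+1.
  by rewrite expr2 size_monicM ?monic_neq0 // sQ /= addnS mul2n addnn.
have lt_c : (size (- (36 * 9)%:P : {poly R})%R < size (Q ^+ 2)%R)%N.
  by rewrite sQ2 size_polyN ltnS (leq_trans (size_polyC_leq1 _)) // muln_gt0.
have a36 : a / 36 != 0 by rewrite mulf_neq0 ?invr_eq0 ?gt_eqF.
exists P, (7 * (108 * a)); split.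
- by rewrite size_scale // size_polyDl // sQ2 ltnS muln_gt0.
- rewrite lead_coefZ lead_coefDl // (monicP _) ?mulr1; last by rewrite monic_exp.
  move=> q z q0; apply/eqP => zE.
  have qa : q%:R * a = (36 * z)%:~R.
    by rewrite rmorphM /= zE; field.
  have /eqP := disc_not_square m1000 (36 * z) (q := q%:Z) q0; apply.
  apply: (@intr_inj R); rewrite rmorphM !rmorphXn /= -qa -aE; ring.
move=> y n z Cy n1000 yr zE; exists `|z|.
have kR : 1000 <= n%:~R :> R by rewrite (ler_int R 1000).
have yrR : 6 * n%:~R + 7 = y%:R ^+ r :> R.
  by rewrite -natrX -[(y ^ r)%:R]/((y ^ r)%N%:~R) -yr rmorphD rmorphM.
have -> : P.[y%:R] = a * (n%:~R ^+ 2 - 9).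
  by rewrite /P /Q !(hornerZ, hornerD, hornerN, horner_exp, hornerX, hornerC) -yrR; field.
have zR : `|z|%:~R ^+ 2 = a ^+ 2 * ((n%:~R ^+ 2 - 9) ^+ 2 - 108) :> R.
  rewrite -rmorphXn /= -normrX ger0_norm ?sqr_ge0 // zE rmorphM /= aE /disc.
  by rewrite !(rmorphB, rmorphXn) /=; ring.
have N20 : 20 <= n%:~R :> R by apply: le_trans kR; rewrite ler_nat.
have y1 : (0 < y)%N.
  rewrite lt0n; apply/eqP => y0; move: yr; rewrite y0 exp0n //.
  by clear -n1000; lia.
have y7N : y%:R <= 7 * n%:~R :> R.
  apply: le_trans (_ : y%:R ^+ r <= _).
    by rewrite -[leLHS]expr1 ler_weXn2l // ler1n.
  by rewrite -yrR; clear -N20; lra.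
have Z0 : 0 <= `|z|%:~R :> R by rewrite ler0z.
move: zR y7N N20 Z0; clear -a0 y1; set Z := `|z|%:~R; set N := n%:~R => zR y7N N20 Z0.
have N29 : N <= N ^+ 2 - 9.
  by rewrite lerBrDr expr2; apply: le_trans (_ : 20 * N <= _); [lra|rewrite ler_wpM2r //; lra].
set A := a * (N ^+ 2 - 9).
have aNA : a * N <= A by rewrite ler_wpM2l // ltW.
have aN0 : 0 < a * N by rewrite mulr_gt0 //; lra.
have AZ : (A - Z) * (A + Z) = 108 * a ^+ 2.
  by rewrite -subr_sqr zR /A; ring.
have y0 : 0 < y%:R :> R by rewrite ltr0n.
have AZ0 : 0 < A + Z by lra.
have d0 : 0 <= A - Z.
  by rewrite -(pmulr_lge0 _ AZ0) AZ mulr_ge0 // sqr_ge0.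
rewrite ger0_norm // ler_pdivlMr //.
apply: le_trans (_ : (A - Z) * (7 * N) <= _); first by rewrite ler_wpM2l.
rewrite -(ler_pM2r a0) (_ : (A - Z) * (7 * N) * a = 7 * ((A - Z) * (a * N))); last by ring.
rewrite (_ : 7 * (108 * a) * a = 7 * (108 * a ^+ 2)); last by ring.
by rewrite ler_wpM2l // -AZ ler_wpM2l //; lra.
Qed.

End NearIntegers.

(** A filler polynomial for the index tuples in [exists_good] that satisfy no obstruction. *)
Lemma exists_irrational_poly (R : archiRcfType) :
  exists2 P : {poly R}, (1 < size P)%N & irrational (lead_coef P).
Proof.
have [a a0 aE] : exists2 a : R, 0 < a & a ^+ 2 = ((2 ^ 1 * 6 ^ 0)%:R)^-1.
  by apply: exists_root => //; rewrite invr_gt0 ltr0n.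
exists (a *: 'X).
  by rewrite size_scale ?gt_eqF // size_polyX.
rewrite lead_coefZ lead_coefX mulr1; apply: (@irrational_root R a 2 1 0) => //.
by rewrite aE mulVf // pnatr_eq0.
Qed.

Lemma irrationalM (R : archiRcfType) (a : R) (k : nat) : (0 < k)%N -> irrational a ->
  irrational (a * k%:R).
Proof.
move=> k0 irr q z q0; rewrite [a * _]mulrC mulrA -natrM.
by apply: irr; rewrite muln_gt0 q0.
Qed.

(** [L] holds the parameters chosen so far. Each obstruction, a relation with given exponents or a
    square discriminant product with a member of [L], puts the value of one of finitely many
    polynomials near an integer, and [exists_far] avoids all of them at once. *)
Lemma exists_good (r : nat) (L : seq int) : (0 < r)%N -> {in L, forall m, 1000 <= m} ->
  exists n : int, [/\ 1000 <= n, ~~ (2 %| n)%Z,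
    forall K : fieldExtType rat, is_K n K -> exists c : class_group K, has_order c r
    & {in L, forall m, forall z, z ^+ 2 != disc m * disc n}].
Proof.
move=> r0 L1000; pose R : archiRcfType := realalg.
pose I : finType := ('I_r.+1 * 'I_r.+1 * 'I_r.+1 * 'I_r.+1 + 'I_(size L))%type.
pose bad (i : I) (y : nat) := match i with
  | inl (p, i, j, k) => [/\ prime p, (p %| r)%N, (0 < i <= p)%N, (0 < j <= p)%N &
     [/\ (k <= p)%N, ~~ ((p %| j) && (p %| i + 3 * j + k))%N & relation_at r p i j k y]]
  | inr l => exists n z : int, [/\ 1000 <= n, 6 * n + 7 = (y ^ r)%N &
     z ^+ 2 = disc (nth 0 L l) * disc n]
  end.
have near_bad (i : I) : exists PC : {poly R} * R, [/\ (1 < size PC.1)%N, irrational (lead_coef PC.1)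
    & forall y, PC.2 <= y%:R -> bad i y -> near_int (PC.2 / y%:R) PC.1.[y%:R]].
  case: i => [[[[p i] j] k]|l] /=; last first.
    have m1000 : 1000 <= nth 0 L l by apply: L1000; rewrite mem_nth.
    have [P [C [sP lP PC]]] := disc_near R r0 m1000.
    by exists (P, C); split=> // y Cy [n [z [n1000 yr zE]]]; apply: (PC y n z).
  have [[pp pr ip jp [kp nd]]|nval] := pselect [/\ prime p, (p %| r)%N, (0 < i <= p)%N,
      (0 < j <= p)%N & (k <= p)%N /\ ~~ ((p %| j) && (p %| i + 3 * j + k))%N].
    have [P [C [sP lP PC]]] := relation_near R r0 pp pr ip jp kp nd.
    by exists (P, C); split=> // y Cy [_ _ _ _ [_ _ rel]]; apply: PC.
  have [P sP lP] := exists_irrational_poly R.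
  by exists (P, 0); split=> // y _ [pp pr ip jp [kp nd _]]; case: nval.
have [PC PCP] := choice near_bad.
pose C := \sum_i `|(PC i).2|.
have CP i : (PC i).2 <= C.
  by apply: le_trans (ler_norm _) _; rewrite /C (bigD1 i) //= lerDl sumr_ge0.
have C0 : 0 <= C by apply: sumr_ge0.
(* 444 = 12 * 37: modulo 12 this makes n an odd integer, and prevents 37 from dividing y. *)
pose lin : {poly R} := 444 *: 'X + 1%:P.
have s444 : size (444 *: 'X : {poly R}) = 2 by rewrite size_scale ?size_polyX ?pnatr_eq0.
have lt_1 : (size (1%:P : {poly R}) < size (444 *: 'X : {poly R})%R)%N.
  by rewrite s444 ltnS size_polyC_leq1.
have s_lin : size lin = 2 by rewrite size_polyDl.
have l_lin : lead_coef lin = 444 by rewrite lead_coefDl // lead_coefZ lead_coefX mulr1.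
pose P i := (PC i).1 \Po lin.
have sP i : (1 < size (P i))%N.
  have pred_gt0 m : (0 < m.-1)%N = (1 < m)%N by case: m => [|[]].
  by have [s1 _ _] := PCP i; rewrite -pred_gt0 size_comp_poly s_lin muln1 pred_gt0.
have lP i : irrational (lead_coef (P i)).
  have [_ irr _] := PCP i; rewrite lead_coef_comp ?s_lin // l_lin -natrX.
  by apply: irrationalM; rewrite ?expn_gt0.
have [w wY far] := exists_far C (maxn (Num.bound C) 100) sP lP.
have {wY} [wC w100] : C <= w%:R /\ (100 <= w)%N.
  move: wY; rewrite geq_max => /andP[wC ->]; split=> //; apply: ltW.
  by apply: lt_le_trans (archi_boundP C0) _; rewrite ler_nat.
pose y := (444 * w + 1)%N.
have wy : (w <= y)%N by rewrite /y; clear; lia.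
have w0 : 0 < w%:R :> R by rewrite ltr0n; apply: leq_trans w100.
have y0 : 0 < y%:R :> R by apply: lt_le_trans w0 _; rewrite ler_nat.
have not_bad i : ~ bad i y.
  move=> bi; have [_ _ near] := PCP i; apply: (far i).
  have yE : y%:R = lin.[w%:R].
    by rewrite /lin hornerD hornerZ hornerX hornerC /y natrD natrM.
  rewrite horner_comp -yE.
  have [|z zP] := near y _ bi.
    by apply: le_trans (CP i) (le_trans wC _); rewrite ler_nat.
  exists z; apply: le_trans zP _.
  apply: le_trans (_ : C / y%:R <= _); first by rewrite ler_wpM2r // invr_ge0 ltW.
  by rewrite ler_wpM2l // lef_pV2 ?posrE // ler_nat.
have [q qE] : exists q, (y ^ r = 444 * q + 1)%N.
  exists (y ^ r %/ 444)%N; rewrite {1}(divn_eq (y ^ r) 444) mulnC; congr (_ + _)%N.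
  by rewrite -modnXm /y mulnC modnMDl -(modnXm r 444) exp1n.
have qw : (w <= q)%N.
  have yyr : (y <= y ^ r)%N by rewrite -{1}[y]expn1 leq_pexp2l // /y addn1.
  by move: yyr; rewrite qE /y leq_add2r leq_pmul2l.
(* This is [(y ^ r - 7) / 6] for [y ^ r = 444 * q + 1]. *)
pose n : int := 74 * q%:Z - 1.
have n1000 : 1000 <= n by rewrite /n; clear -qw w100; lia.
have n_odd : ~~ (2 %| n)%Z by rewrite /n; clear; lia.
have yr : 6 * n + 7 = (y ^ r)%N by rewrite qE /n; clear; lia.
have y37 : coprime 37 y.
  by rewrite prime_coprime // /y dvdn_addr // dvdn_mulr.
exists n; split=> //; last first.
  move=> m mL z; apply/eqP => zE.
  apply: (not_bad (inr (Ordinal (_ : (index m L < size L)%N)))); first by rewrite index_mem.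
  by move=> lt_m /=; exists n, z; rewrite nth_index.
move=> K [rho rho0 K_gen].
have n100 : 100 <= n by apply: le_trans n1000.
have [s1 [s2 [s3 [[e1 e2 e3] [r1_bnd r2_bnd r3_bnd]]]]] := exists_conjugates R n100 rho0 K_gen.
have [//|[p [i [j [k [pp pr [ip jp kp nd rel]]]]]]] :=
  class_or_relation n1000 n_odd rho0 K_gen e1 e2 e3 r1_bnd r2_bnd r3_bnd r0 yr y37.
have pr_le : (p <= r)%N := dvdn_leq r0 pr.
have [ilt jlt klt] : [/\ i < r.+1, j < r.+1 & k < r.+1]%N.
  case/andP: ip => _ ip; case/andP: jp => _ jp.
  by split; rewrite ltnS (leq_trans _ pr_le).
exfalso; apply: (not_bad (inl
  (Ordinal (pr_le : (p < r.+1)%N), Ordinal ilt, Ordinal jlt, Ordinal klt))) => /=.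
by split=> //; split=> //; exists n, K, rho.
Qed.

Theorem theorem4p1 (r : nat) (r_gt0 : (0 < r)%N) (r_mod3 : ~~ (3 %| r)%N) :
  exists K : nat -> fieldExtType rat,
    [/\ forall i, family_F (K i),
        forall i j, i <> j -> ~ field_iso (K i) (K j)
      & forall i, exists c : class_group (K i), has_order c r].
Proof.
have [f fP] := choice (fun L : {L : seq int | all (fun m => 1000 <= m) L} =>
  exists_good r_gt0 (fun m mL => allP (svalP L) m mL)).
(* The recursion carries all earlier parameters, so that each new one avoids every one of them,
   together with the lower bound that [exists_good] requires. *)
pose Ls := fix Ls k : {L : seq int | all (fun m => 1000 <= m) L} :=
  if k is k'.+1 then
    exist _ (f (Ls k') :: sval (Ls k'))
      (introT andP (conj (let: And4 h _ _ _ := fP (Ls k') in h) (svalP (Ls k'))))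
  else exist _ [::] isT.
pose ns k := f (Ls k).
have ns_in i j : (i < j)%N -> ns i \in sval (Ls j).
  elim: j => // j IH; rewrite ltnS leq_eqVlt => /orP[/eqP->|/IH ij] /=; first exact: mem_head.
  by rewrite inE ij orbT.
have ns_sq i j : i <> j -> forall z, z ^+ 2 != disc (ns i) * disc (ns j).
  move=> /eqP; rewrite neq_ltn => /orP[ij|ji] z.
    by have [_ _ _] := fP (Ls j); apply; apply: ns_in.
  by rewrite mulrC; have [_ _ _] := fP (Ls i); apply; apply: ns_in.
have ns1000 i : 1000 <= ns i by have [] := fP (Ls i).
have ns0 i : ns i != 0 by apply: contraTneq (ns1000 i) => ->.
have [K KP] := choice (fun i => exists_K (ns0 i)).
exists K; split.
- move=> i; exists (ns i); split=> //; first by apply: le_trans (ns1000 i).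
  by have [] := fP (Ls i).
(* A morphism sends [rho] to a root of f_(ns i) in [K j], so [disc_square] would make the product of
   the two discriminants a square. *)
- move=> i j ij [phi _]; have [rho rho0 _] := KP i; have [rho' rho'0 K_gen'] := KP j.
  have x0 : root (map_poly intr (f_poly (ns i))) (phi rho).
    rewrite (_ : map_poly _ _ = map_poly phi (map_poly intr (f_poly (ns i)))) ?fmorph_root //.
    by rewrite -map_poly_comp; apply: eq_map_poly => z /=; rewrite rmorph_int.
  have n100 : 100 <= ns j by apply: le_trans (ns1000 j).
  have [s1 [s2 [s3 [[e1 e2 e3] _]]]] := exists_conjugates realalg n100 rho'0 K_gen'.
  have [z zE] := disc_square (ns0 j) rho'0 K_gen' e1 e2 e3 (ns0 i) x0.
  by have := ns_sq i j ij z; rewrite zE eqxx.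
- by move=> i; have [_ _ + _] := fP (Ls i); apply; apply: KP.
Qed.
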